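(* Let $\mathbb{X}$ be a finite filtered cell complex with injective filter map $f:\mathbb{X}\to\{1,\dots,N\}$ and let $\mathbb{A},\mathbb{B}\subseteq\mathbb{X}$ be disjoint non-empty subcomplexes. Then the cobordism pairing algorithm (described in the context) correctly pairs the birth and death times in the persistence module $\operatorname{Cok}(\Phi)$. That is: the death times of $\operatorname{Cok}(\Phi)$ are exactly the values $f(\tau)$ for those cells $\tau$ that index two columns (a double column) of the matrix $D^{\Phi}$; for each such $\tau$, the birth time paired with the death time $f(\tau)$ is $f(\sigma)$, where $\sigma$ is the cell indexing the row of the lowest $1$ in the second $\tau$-column of the reduced matrix $R^{\Phi}$; and the birth times of $\operatorname{Cok}(\Phi)$ not matched to a death in this way are exactly the unpaired birth times, i.e. those corresponding to classes that live forever.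
   Context: SETTING. A finite cell complex means a regular CW complex with finitely many cells. Homology has coefficients in $\mathbb{Z}/2\mathbb{Z}$, $H_*=\bigoplus_k H_k$. A filter map assigns to each cell $\sigma$ a number $f(\sigma)$ such that $\tau\subseteq\sigma$ implies $f(\tau)\le f(\sigma)$; it is assumed injective with image $\{1,\dots,N\}$. Put $\mathbb{X}_i=f^{-1}((-\infty,i])$, $\mathbb{A}_i=\mathbb{A}\cap\mathbb{X}_i$, $\mathbb{B}_i=\mathbb{B}\cap\mathbb{X}_i$ for $i=0,\dots,N$. For $\mathbb{S}\in\{\mathbb{A},\mathbb{B},\mathbb{A}\cup\mathbb{B}\}$ let $\mathbb{S}_i=\mathbb{S}\cap\mathbb{X}_i$ and let $\operatorname{Ker}(\iota^{\mathbb{S}}_* )$ be the persistence module with $i$-th space $\operatorname{Ker}(H_*(\mathbb{S}_i)\to H_*(\mathbb{X}_i))$ (map induced by inclusion). The persistence module $\operatorname{Cok}(\Phi)$ has $i$-th space the cokernel of the natural map $$\Phi_i:\operatorname{Ker}(\iota^{\mathbb{A}}_* )_i\oplus\operatorname{Ker}(\iota^{\mathbb{B}}_* )_i\to\operatorname{Ker}(\iota^{\mathbb{A}\cup\mathbb{B}}_* )_i$$ induced by inclusions; all structure maps are induced by inclusions. BIRTHS, DEATHS, PAIRING. In each such module $M$ the dimension changes by at most one at each step; $t$ is a birth time if $\dim M_t=\dim M_{t-1}+1$ and a death time if $\dim M_t=\dim M_{t-1}-1$. A death time $d$ is paired with the birth time $b$ of the earliest born class that dies at time $d$: $b$ is the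 smallest index such that the image of $M_b\to M_{d-1}$ contains a non-zero element of the kernel of $M_{d-1}\to M_d$. Unpaired birth times correspond to infinite cycles, i.e. classes that remain alive at time $N$. COLUMN REDUCTION. All matrices are over $\mathbb{Z}/2\mathbb{Z}$. The lowest $1$ of a non-zero column is its $1$ in the lowest position (largest row index in the given row order). The standard column reduction of a matrix $D$ processes columns from left to right; while the current column is non-zero and has its lowest $1$ in the same row as the lowest $1$ of some column to its left, that left column is added to it. It yields $R=DV$, where $R$ is reduced and $V$ records the column operations. $M[\tau]$ denotes the column of $M$ indexed by the cell $\tau$. PRELIMINARY MATRICES. Let $D^{\mathbb{X}}$ be the boundary matrix of $\mathbb{X}$ with rows and columns ordered by $f$. For $\mathbb{S}\in\{\mathbb{A},\mathbb{B}\}$, $D^{\mathbb{S}}_{Im}$ is obtained from $D^{\mathbb{X}}$ by reordering the rows (not the columns) so that cells in $\mathbb{S}$ come first, followed by the cells in $\mathbb{X}\setminus\mathbb{S}$, each block ordered by $f$. Standard column reduction gives $R^{\mathbb{S}}_{Im}=D^{\mathbb{S}}_{Im}V^{\mathbb{S}}_{Im}$. COBORDISM PAIRING ALGORITHM. Input: the matrices $R^{\mathbb{A}}_{Im}, V^{\mathbb{A}}_{Im}, R^{\mathbb{B}}_{Im}, V^{\mathbb{B}}_{Im}$ and the birth and death times of $\operatorname{Ker}(\iota^{\mathbb{A}}_* )$, $\operatorname{Ker}(\iota^{\mathbb{B}}_* )$, $\operatorname{Ker}(\iota^{\mathbb{A}\cup\mathbb{B}}_* )$. Step 1. Reorder the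 rows of $V^{\mathbb{A}}_{Im}$ and $V^{\mathbb{B}}_{Im}$ consistently so that the cells of $\mathbb{A}\cup\mathbb{B}$ come before those of $\mathbb{X}\setminus(\mathbb{A}\cup\mathbb{B})$, with the rows of the $\mathbb{X}\setminus(\mathbb{A}\cup\mathbb{B})$ block ordered by filtration value. Step 2. Let $D^{\Phi}$ consist of the columns of $V^{\mathbb{A}}_{Im}$ whose corresponding columns in $R^{\mathbb{A}}_{Im}$ are zero. Columns of $D^{\Phi}$ are indexed by cells and kept ordered by filtration value throughout. Step 3. For each cell $\tau\in\mathbb{X}$: - if $R^{\mathbb{A}}_{Im}[\tau]$ is non-zero with lowest $1$ in an $\mathbb{A}$-row, insert $V^{\mathbb{A}}_{Im}[\tau]$ into $D^{\Phi}$ as a $\tau$-column; - then, if $R^{\mathbb{B}}_{Im}[\tau]$ is non-zero with lowest $1$ in a $\mathbb{B}$-row: if $D^{\Phi}$ has no $\tau$-column, insert $V^{\mathbb{B}}_{Im}[\tau]$ as a $\tau$-column; otherwise, if $\tau\in\mathbb{A}$, insert $V^{\mathbb{B}}_{Im}[\tau]$ immediately after the existing $\tau$-column, and if $\tau\notin\mathbb{A}$, insert it immediately before the existing $\tau$-column. Step 4. Run the standard column reduction on $D^{\Phi}$ to get $R^{\Phi}=D^{\Phi}V^{\Phi}$. Step 5. Each cell $\tau$ indexing two columns of $D^{\Phi}$ is declared to give a death time $f(\tau)$; the filtration value of the row of the lowest $1$ in the second $\tau$-column of $R^{\Phi}$ is declared the corresponding birth time. Step 6. The birth times of $\operatorname{Cok}(\Phi)$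 are computed as the times at which a class is born in $\operatorname{Ker}(\iota^{\mathbb{A}\cup\mathbb{B}}_* )$ but in neither $\operatorname{Ker}(\iota^{\mathbb{A}}_* )$ nor $\operatorname{Ker}(\iota^{\mathbb{B}}_* )$. Those not matched to a death in Step 5 are declared to correspond to infinite cycles. *)

(* Defs.v *)
From HB Require Import structures.
From mathcomp Require Import all_boot all_order all_algebra.

Set Implicit Arguments.
Unset Strict Implicit.
Unset Printing Implicit Defensive.

Import GRing.Theory.
Local Open Scope ring_scope.

(* A finite regular CW complex is recorded by its face poset: [face t s] means *)
(* that the cell t is contained in the closure of the cell s. The axioms are   *)
(* standard properties of these posets; the diamond property makes the mod 2   *)
(* cellular boundary square to zero.                                           *)
Record cell_complex := CellComplex {
  cell :> finType;
  cell_dim : cell -> nat;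
  face : rel cell;
  face_refl : reflexive face;
  face_trans : transitive face;
  face_dim : forall t s, face t s -> t != s -> (cell_dim t < cell_dim s)%N;
  face_graded : forall t s, face t s -> t != s ->
    exists r, [&& face t r, face r s & cell_dim r == (cell_dim t).+1];
  face_boundary : forall s, (0 < cell_dim s)%N -> exists2 t, face t s & t != s;
  face_edge : forall s, cell_dim s = 1%N -> #|[set t | face t s & t != s]| = 2%N;
  face_diamond : forall t s, face t s -> cell_dim s = (cell_dim t).+2 ->
    #|[set r | [&& face t r, face r s, r != t & r != s]]| = 2%N
}.

Arguments cell_dim {_}.
Arguments face {_}.

Section Quotient.

Context (K : fieldType).

Section Def.

Context (E : vectType K) (U : {vspace E}).

(* The quotient E / U, carried by a complement of U. *)
Definition quot : vectType K := subvs_of (U^C)%VS.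

Definition quot_pi : 'Hom(E, quot) :=
  (linfun (vsproj U^C) \o daddv_pi U^C U)%VF.

Fact quot_dec x : daddv_pi U^C U x + daddv_pi U U^C x = x.
Proof.
apply: daddv_pi_add; first by rewrite capvC capv_compl.
by rewrite addvC addv_complf memvf.
Qed.

Lemma quot_pi_surj : limg quot_pi = fullv.
Proof.
apply/vspaceP => x; rewrite memvf.
apply/memv_imgP; exists (vsval x); first exact: memvf.
rewrite comp_lfunE lfunE /= daddv_pi_id ?vsvalK ?subvsP //.
by rewrite capvC capv_compl.
Qed.

Lemma quot_pi_ker : lker quot_pi = U.
Proof.
have dUC : (U^C :&: U = 0)%VS by rewrite capvC capv_compl.
apply/vspaceP => x; rewrite memv_ker comp_lfunE lfunE /=.
apply/eqP/idP => [px0 | Ux].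
  have := vsprojK (memv_pi U^C U x); rewrite px0 linear0 => p0.
  by rewrite -(quot_dec x) -p0 add0r memv_pi.
suff -> : daddv_pi U^C U x = 0 by rewrite linear0.
by apply: (addIr x); rewrite add0r -{2}(daddv_pi_id (capv_compl U) Ux) quot_dec.
Qed.

End Def.

(* The map E / U -> E' / U' induced by g, meaningful when g maps U into U'. *)
Definition quot_map (E E' : vectType K) (g : 'Hom(E, E'))
    (U : {vspace E}) (U' : {vspace E'}) : 'Hom(quot U, quot U') :=
  (quot_pi U' \o g \o linfun vsval)%VF.

Lemma quot_mapE (E E' : vectType K) (g : 'Hom(E, E')) U U' x :
  (g @: U <= U')%VS -> quot_map g U U' (quot_pi U x) = quot_pi U' (g x).
Proof.
move=> gUU'; set y := daddv_pi U^C U x.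
have -> : quot_map g U U' (quot_pi U x) = quot_pi U' (g y).
  rewrite [LHS]comp_lfunE [in LHS]comp_lfunE [linfun vsval _]lfunE /=.
  rewrite [X in vsval X]comp_lfunE [X in vsval X]lfunE /=.
  by rewrite vsprojK // memv_pi.
rewrite -[in RHS](quot_dec U x) !linearD /= -/y -[LHS]addr0.
congr (_ + _); apply/esym/eqP; rewrite -memv_ker quot_pi_ker.
by apply: (subvP gUU'); rewrite memv_img // memv_pi.
Qed.

(* The map U -> U' that g restricts to, meaningful when g maps U into U'. *)
Definition restr_map (E E' : vectType K) (g : 'Hom(E, E'))
    (U : {vspace E}) (U' : {vspace E'}) : 'Hom(subvs_of U, subvs_of U') :=
  (linfun (vsproj U') \o g \o linfun vsval)%VF.

Lemma restr_mapE (E E' : vectType K) (g : 'Hom(E, E')) U U' x :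
  (g @: U <= U')%VS -> vsval (restr_map g U U' x) = g (vsval x).
Proof.
move=> gUU'; rewrite !comp_lfunE /= !lfunE /= vsprojK //.
by rewrite (subvP gUU') // memv_img // subvsP.
Qed.

End Quotient.

Section Homology.

Context (X : cell_complex).

Definition subcomplex (S : {set X}) : Prop :=
  forall t s, face t s -> s \in S -> t \in S.

Definition chain : vectType 'F_2 := {ffun X -> ('F_2)^o}.

Definition cell_chain (s : X) : chain := [ffun t => (t == s)%:R].

Definition facet (t s : X) : bool := face t s && (cell_dim s == (cell_dim t).+1).

Definition boundary_fun (c : chain) : chain :=
  [ffun t => \sum_(s | facet t s) c s].

Fact boundary_fun_is_linear : linear boundary_fun.
Proof.
move=> a c c'; apply/ffunP => t; rewrite !ffunE scaler_sumr -big_split /=.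
by apply: eq_bigr => s _; rewrite !ffunE.
Qed.

HB.instance Definition _ :=
  GRing.isLinear.Build 'F_2 chain chain _ boundary_fun boundary_fun_is_linear.

Definition boundary : 'End(chain) := linfun boundary_fun.

Lemma boundary_boundary c : boundary (boundary c) = 0.
Proof.
rewrite !lfunE /=; apply/ffunP => t; rewrite !ffunE.
under eq_bigr => r _ do rewrite ffunE big_mkcond.
rewrite exchange_big /= big1 // => s _.
rewrite -big_mkcondr /= sumr_const.
have [/andP[ts /eqP ds]|nts] := boolP (face t s && (cell_dim s == (cell_dim t).+2)).
  rewrite (_ : #|_| = 2%N); last first.
    apply: etrans (face_diamond ts ds); rewrite cardsE; apply: eq_card => r.
    rewrite !unfold_in /= /facet ds; apply/idP/idP.
      case/andP=> /andP[-> /eqP dr] /andP[-> _] /=; apply/andP; split.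
        by apply/eqP => rt; move: dr; rewrite rt => /n_Sn.
      by apply/eqP => rs; move: ds; rewrite -rs dr => -[] /n_Sn.
    case/and4P=> tr rs rt rns.
    have := face_dim tr; rewrite eq_sym => /(_ rt) lt1.
    have := face_dim rs rns; rewrite ds ltnS => le2.
    rewrite tr rs (_ : cell_dim r = (cell_dim t).+1) ?eqxx //.
    by apply/eqP; rewrite eqn_leq le2.
  by rewrite mulr2n; apply: val_inj => /=; case: (c s) => -[|[|?]].
rewrite (_ : #|_| = 0%N) ?mulr0n //; apply: eq_card0 => r; rewrite unfold_in /facet /=.
apply: contraNF nts => /andP[/andP[tr /eqP dr] /andP[rs /eqP ds]].
by rewrite (face_trans tr rs) ds dr /=.
Qed.

Definition chains (S : {set X}) : {vspace chain} :=
  (\sum_(s in S) <[cell_chain s]>)%VS.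

Definition cycles (S : {set X}) : {vspace chain} :=
  (chains S :&: lker boundary)%VS.

(* The space of boundaries of a subcomplex S, inside its space of cycles. *)
Definition bounds (S : {set X}) : {vspace subvs_of (cycles S)} :=
  (linfun vsval @^-1: (boundary @: chains S))%VS.

(* Total homology: as chains of all dimensions are taken together and the      *)
(* boundary is homogeneous of degree -1, this is the sum of the H_k.           *)
Definition homology (S : {set X}) : vectType 'F_2 := quot (bounds S).

(* The map induced by the inclusion of S in T, when S \subset T. *)
Definition homology_map (S T : {set X}) : 'Hom(homology S, homology T) :=
  quot_map (restr_map \1%VF (cycles S) (cycles T)) (bounds S) (bounds T).

Definition homology_ker (S T : {set X}) : {vspace homology S} :=
  lker (homology_map S T).

End Homology.

(* Only the maps [pmap M i j] with i <= j are meaningful. *)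
Record persistence_module := PersistenceModule {
  pspace : nat -> vectType 'F_2;
  pmap : forall i j, 'Hom(pspace i, pspace j)
}.

Section Pairing.

Context (M : persistence_module).

Definition pdim (t : nat) : nat := \dim {: pspace M t}.

Definition birth (t : nat) : Prop := (0 < t)%N /\ pdim t = (pdim t.-1).+1.

Definition death (t : nat) : Prop := (0 < t)%N /\ pdim t.-1 = (pdim t).+1.

Definition class_dies (b d : nat) : bool :=
  (limg (pmap M b d.-1) :&: lker (pmap M d.-1 d) != 0)%VS.

Definition paired (b d : nat) : Prop :=
  [/\ birth b, death d, (b < d)%N, class_dies b d
    & forall b', (b' < b)%N -> ~~ class_dies b' d].

Definition unpaired_birth (b : nat) : Prop :=
  birth b /\ forall d, ~ paired b d.

(* Some class of M_b is at time n still not the image of a class of M_(b-1). *)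
Definition alive_at (n b : nat) : Prop :=
  birth b /\ ~~ (limg (pmap M b n) <= limg (pmap M b.-1 n))%VS.

End Pairing.

Definition is_filter_map (X : cell_complex) (N : nat) (f : X -> nat) : Prop :=
  [/\ injective f,
      forall i, (exists s, f s = i) <-> (1 <= i <= N)%N
    & forall t s, face t s -> (f t <= f s)%N].

Section Modules.

Context (X : cell_complex) (f : X -> nat).

Definition sublevel (i : nat) : {set X} := [set s | (f s <= i)%N].

Definition ker_space (S : {set X}) (i : nat) :
    {vspace homology (S :&: sublevel i)} :=
  homology_ker (S :&: sublevel i) (sublevel i).

(* The map Ker_i -> Ker_j induced by the inclusion of S_i in T_j; it is used   *)
(* for S = T and i <= j, and for S \subset T and i = j.                        *)
Definition ker_map (S T : {set X}) (i j : nat) :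
    'Hom(subvs_of (ker_space S i), subvs_of (ker_space T j)) :=
  restr_map (homology_map (S :&: sublevel i) (T :&: sublevel j))
    (ker_space S i) (ker_space T j).

Definition Ker_module (S : {set X}) : persistence_module :=
  PersistenceModule (ker_map S S).

Context (A B : {set X}).

Definition Phi (i : nat) :
    'Hom((subvs_of (ker_space A i) * subvs_of (ker_space B i))%type,
         subvs_of (ker_space (A :|: B) i)) :=
  linfun (fun p => ker_map A (A :|: B) i i p.1 + ker_map B (A :|: B) i i p.2).

Definition Cok_Phi_module : persistence_module :=
  @PersistenceModule (fun i => quot (limg (Phi i))) (fun i j =>
    quot_map (ker_map (A :|: B) (A :|: B) i j) (limg (Phi i)) (limg (Phi j))).

End Modules.

Section ColumnReduction.

(* A matrix with rows indexed by cells is the sequence of its columns, each of *)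
(* them a chain; the order of its rows is given by [rho].                      *)
Context (X : cell_complex) (rho : X -> nat).

Definition low (c : chain X) : option X :=
  [pick s | (c s != 0) && [forall t, (c t != 0) ==> (rho t <= rho s)%N]].

Definition low_in (S : {set X}) (c : chain X) : bool :=
  if low c is Some s then s \in S else false.

(* [W] carries the column, read by [col], with any record of the operations.   *)
Context (W : zmodType) (col : W -> chain X).

Definition reduce_step (left : seq W) (w : W) : W :=
  if [seq w' <- left | (col w != 0) && (low (col w') == low (col w))]
    is w' :: _ then w + w' else w.

(* Each addition moves the lowest 1 strictly up, so the loop stops within as   *)
(* many rounds as there are rows.                                              *)
Definition reduce_column (left : seq W) (w : W) : W :=
  iter #|X| (reduce_step left) w.

Definition column_reduction (D : seq W) : seq W :=
  foldl (fun left w => rcons left (reduce_column left w)) [::] D.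

End ColumnReduction.

Section Algorithm.

Context (X : cell_complex) (N : nat) (f : X -> nat).

Definition cells : seq X := sort (relpre f leq) (enum X).

(* Cells of S first, then the others, for f with values in {1, ..., N}. *)
Definition im_order (S : {set X}) (s : X) : nat :=
  if s \in S then f s else (N + f s)%N.

(* The columns of D_Im paired with those of the identity matrix, reduced to    *)
(* the columns of R_Im paired with those of V_Im.                              *)
Definition RV_Im (S : {set X}) : seq (chain X * chain X) :=
  column_reduction (im_order S) fst
    [seq (boundary X (cell_chain s), cell_chain s) | s <- cells].

Definition R_Im (S : {set X}) (tau : X) : chain X :=
  (nth 0 (RV_Im S) (index tau cells)).1.

Definition V_Im (S : {set X}) (tau : X) : chain X :=
  (nth 0 (RV_Im S) (index tau cells)).2.

Context (A B : {set X}).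

(* The order inside A :|: B is left free. *)
Definition phi_order (rho : X -> nat) : Prop :=
  [/\ injective rho,
      forall s t, s \in A :|: B -> t \notin A :|: B -> (rho s < rho t)%N
    & forall s t, s \notin A :|: B -> t \notin A :|: B ->
        (rho s < rho t)%N = (f s < f t)%N].

Definition phi_columns (tau : X) : seq (chain X) :=
  let colA :=
    if (R_Im A tau == 0) || low_in (im_order A) A (R_Im A tau)
    then [:: V_Im A tau] else [::] in
  if low_in (im_order B) B (R_Im B tau) then
    if tau \in A then rcons colA (V_Im B tau) else V_Im B tau :: colA
  else colA.

Definition D_Phi : seq (X * chain X) :=
  [seq (tau, c) | tau <- cells, c <- phi_columns tau].

Definition double_column (tau : X) : Prop := count_mem tau (unzip1 D_Phi) = 2%N.

Definition R_Phi (rho : X -> nat) : seq (X * chain X) :=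
  zip (unzip1 D_Phi) (column_reduction rho id (unzip2 D_Phi)).

Definition second_column (rho : X -> nat) (tau : X) : chain X :=
  nth 0 [seq p.2 | p <- R_Phi rho & p.1 == tau] 1%N.

Definition matched (rho : X -> nat) (b d : nat) : Prop :=
  exists tau sigma, [/\ double_column tau,
    low rho (second_column rho tau) = Some sigma, b = f sigma & d = f tau].

Definition declared_birth (t : nat) : Prop :=
  [/\ birth (Ker_module f (A :|: B)) t, ~ birth (Ker_module f A) t
    & ~ birth (Ker_module f B) t].

End Algorithm.

(* Main.v *)
From HB Require Import structures.
Require Import Defs.
From mathcomp Require Import all_boot all_order all_algebra.
From mathcomp Require Import zify.

Set Implicit Arguments.
Unset Strict Implicit.
Unset Printing Implicit Defensive.

Import GRing.Theory.
Local Open Scope ring_scope.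

(** Everything is carried back to the space of chains of X. Write C_i for the
chains of the sublevel complex X_i, Z for the cycles of X and, for a subcomplex
S, P^S for the chains whose boundary lies in S ([relcycles S]). A cycle of S_i
that bounds in X_i is the boundary of a chain of P^S in C_i, so the boundary
identifies
  - Ker(S)_i with (P^S meet C_i) / ((C(S) meet C_i) + (Z meet C_i)),
  - Cok_i with (P^(A u B) meet C_i) / L_i, where
    L_i = (P^A meet C_i) + (P^B meet C_i),
compatibly with the structure maps ([Ker_presents], [Cok_presents]). Both have
the shape W_i / (U_i + V_i), and each of the spaces W_i, U_i, V_i, U_i meet V_i
gains one dimension exactly when some chain in it has the new cell as its last
cell ([lead]). Hence a class is born when W gains a dimension and U, V do not
([birth_lead]), and one dies when both U and V gain one but U meet V does not
([death_lead]). As P^A meet P^B = Z, deaths of the cokernel happen at the cells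
that are last in a chain of P^A and in one of P^B but in no cycle.

On the algorithm side, a column reduced against its predecessors has the
smallest possible lowest 1 among all the columns that differ from the given one
by a combination of the predecessors ([reduced_low_min]). For the two image
matrices this says that the column of tau in R is zero, or has its lowest 1 in
S, exactly when tau is last in a cycle, or in a chain of P^S; the columns of V
are such chains ([R_Im_eq0], [low_in_R_Im], [V_Im_relcycles]). So the columns
of D_Phi up to time i span L_i ([sum_phi_columns]), and the double columns sit
at the deaths of the cokernel.

For a double column at tau, i = f tau, let c be its first column. The reduced
second column R has the smallest lowest 1 among the chains of L_i outside
L_(i-1) + <c>. All chains of A u B in X_i lie in L_(i-1) + <c>, which is what
the order of the two columns is for; hence the lowest 1 of R, at sigma say, is
outside A u B, and deleting from R its cells in A u B leaves a chain r of C_b,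
b = f sigma, that lies in L_i but not in L_(i-1). It represents a class of Cok_b
that dies at time i, and minimality of the lowest 1 shows that no class born
before b does ([second_column_low], [double_paired]).

A birth t fails to survive to time N when some chain of L_N has the cell of t as
its last cell. At the first time i for which L_i contains such a chain a class
dies, and comparing the chain with the r above shows that the death at i is
paired with t ([unpaired_alive]). *)

(** * Chains, relative cycles and the filtration *)

Section Chains.
Context (X : cell_complex).
Implicit Types (S T : {set X}) (c : chain X) (U V : {vspace chain X}).

Lemma F2_neq0 (a : 'F_2) : a != 0 -> a = 1.
Proof. by case: a => -[|[|m]] //= lt _; apply: val_inj. Qed.

Lemma chainsP S c : reflect (forall s, c s != 0 -> s \in S) (c \in chains S).
Proof.
apply: (iffP memv_sumP) => [[u uS ->] s | cS].
  apply: contraR => sS; rewrite sum_ffunE big1 // => t tS.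
  have /vlineP[k ->] := uS t tS; rewrite !ffunE.
  by case: eqP => [st|_]; rewrite ?scaler0 //; rewrite st tS in sS.
exists (fun s => c s *: cell_chain s) => [s _|]; first by rewrite memvZ ?memv_line.
apply/ffunP => t; rewrite sum_ffunE.
have [tS|tS] := boolP (t \in S).
  rewrite (bigD1 t) //= big1 => [|s /andP[_ st]]; rewrite !ffunE.
    by rewrite eqxx addr0 [RHS]mulr1.
  by rewrite eq_sym (negPf st) scaler0.
rewrite big1 => [|s sS]; first by apply/eqP; apply: contraR tS; exact: cS.
by rewrite !ffunE; case: eqP => [ts|_]; rewrite ?scaler0 //; rewrite ts sS in tS.
Qed.

Lemma mem_cell_chain S s : (cell_chain s \in chains S) = (s \in S).
Proof.
apply/chainsP/idP => [|sS t]; first by apply; rewrite ffunE eqxx.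
by rewrite ffunE; have [->|] := eqVneq t s; rewrite ?eqxx.
Qed.

Lemma chainsI S T : chains (S :&: T) = (chains S :&: chains T)%VS.
Proof.
apply/vspaceP => c; rewrite memv_cap; apply/chainsP/andP => [cST | [/chainsP cS /chainsP cT] s cs].
  by split; apply/chainsP => s /cST; rewrite inE => /andP[].
by rewrite inE cS ?cT.
Qed.

Lemma chainsS S T : S \subset T -> (chains S <= chains T)%VS.
Proof. by move=> /subsetP ST; apply/subvP => c /chainsP cS; apply/chainsP => s /cS/ST. Qed.

Lemma chainsU S T : chains (S :|: T) = (chains S + chains T)%VS.
Proof.
apply/eqP; rewrite eqEsubv subv_add !chainsS ?subsetUl ?subsetUr // !andbT.
apply/subv_sumP => s; rewrite inE => /orP[] sS.
  by apply: subv_trans (addvSl _ _); rewrite (sumv_sup s).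
by apply: subv_trans (addvSr _ _); rewrite (sumv_sup s).
Qed.

Lemma boundary_chains S c :
  subcomplex S -> c \in chains S -> boundary X c \in chains S.
Proof.
move=> subS /chainsP cS; apply/chainsP => t; rewrite lfunE /= ffunE => nz.
have [s /andP[ts _] cs] : exists2 s, facet t s & c s != 0.
  by apply/exists_inP; apply: contraR nz => /exists_inPn h; rewrite big1 // => s /h /negPn/eqP.
exact: subS ts (cS s cs).
Qed.

(** The boundary maps the chains of [relcycles S] supported in a sublevel complex
onto the cycles of S that bound there, so that quotients of these spaces of
chains can stand for the kernels and for their cokernel. *)
Definition relcycles S : {vspace chain X} := (boundary X @^-1: chains S)%VS.

Lemma mem_relcycles S c : (c \in relcycles S) = (boundary X c \in chains S).
Proof. by rewrite memv_preim. Qed.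

Lemma relcyclesS S T : S \subset T -> (relcycles S <= relcycles T)%VS.
Proof. by move=> ST; apply/subvP=> c; rewrite !mem_relcycles; apply: subvP; exact: chainsS. Qed.

(** A boundary in two disjoint subcomplexes is zero. *)
Lemma relcyclesI S T :
  [disjoint S & T] -> (relcycles S :&: relcycles T = lker (boundary X))%VS.
Proof.
move=> dST; apply/vspaceP => c; rewrite memv_cap !mem_relcycles -memv_cap -chainsI memv_ker.
apply/chainsP/eqP => [h | -> s]; last by rewrite ffunE eqxx.
apply/ffunP => s; rewrite ffunE; apply/eqP; apply/negPn/negP => /h.
by rewrite (disjoint_setI0 dST) inE.
Qed.

Lemma chains_relcycles S : subcomplex S -> (chains S <= relcycles S)%VS.
Proof. by move=> sS; apply/subvP => c cS; rewrite mem_relcycles boundary_chains. Qed.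

Lemma lker_relcycles S : (lker (boundary X) <= relcycles S)%VS.
Proof. by apply/subvP => c; rewrite mem_relcycles memv_ker => /eqP ->; rewrite mem0v. Qed.

Section Filtration.
Context (f : X -> nat).
Hypotheses (f_inj : injective f) (f_gt0 : forall s, (0 < f s)%N).

Definition upto (i : nat) : {vspace chain X} := chains (sublevel f i).
Definition filt U (i : nat) : {vspace chain X} := (U :&: upto i)%VS.
(** The cells enter one at a time, so this tells whether the cell of filtration
value i is the last cell of some chain in U, see [leadP]. *)
Definition lead U (i : nat) : bool := ~~ (filt U i <= upto i.-1)%VS.

Lemma uptoP i c : reflect (forall s, c s != 0 -> (f s <= i)%N) (c \in upto i).
Proof. by apply: (iffP (chainsP _ _)) => h s /h; rewrite inE. Qed.

Lemma uptoS i j : (i <= j)%N -> (upto i <= upto j)%VS.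
Proof. by move=> ij; apply: chainsS; apply/subsetP => s; rewrite !inE => /leq_trans; apply. Qed.

Lemma filtS U i j : (i <= j)%N -> (filt U i <= filt U j)%VS.
Proof. by move=> ij; rewrite capvS ?uptoS. Qed.

Lemma filtSl U V i : (U <= V)%VS -> (filt U i <= filt V i)%VS.
Proof. by move=> UV; rewrite capvS. Qed.

Lemma upto_pred s c : (c \in upto (f s).-1) = (c \in upto (f s)) && (c s == 0).
Proof.
apply/uptoP/andP => [h | [/uptoP h cs0] t ct].
  split; first by apply/uptoP => t /h/leq_trans; apply; exact: leq_pred.
  by apply/negPn/negP => /h; rewrite -ltnS prednK // ltnn.
rewrite -ltnS prednK // ltn_neqAle h // andbT.
by apply: contraNN ct => /eqP/f_inj ->.
Qed.

Lemma lead_cell U i : lead U i -> exists s, f s = i.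
Proof.
case/subvPn => c /[!memv_cap]/andP[_ /uptoP ci] /uptoP nci.
have [s /andP[cs] /eqP fs|h] := pickP (fun s => (c s != 0) && (f s == i)); first by exists s.
case: nci => s cs; rewrite -ltnS; move: (h s); rewrite cs /= => /negbT fsi.
have := ci s cs; rewrite leq_eqVlt (negPf fsi) /= => lt; apply: leq_trans lt _.
exact: leqSpred.
Qed.

Lemma leadP U s : reflect (exists c, [/\ c \in U, c \in upto (f s) & c s = 1]) (lead U (f s)).
Proof.
apply: (iffP (@subvPn _ _ (filt U (f s)) (upto (f s).-1))) => -[c].
  rewrite memv_cap upto_pred => /andP[cU cs]; rewrite cs /= => /F2_neq0 c1.
  by exists c.
by case=> cU cs c1; exists c; rewrite ?memv_cap ?cU // upto_pred cs c1.
Qed.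

Lemma lead_sub U V i : (U <= V)%VS -> lead U i -> lead V i.
Proof. by move=> UV; apply: contra; apply: subv_trans; exact: filtSl. Qed.

Lemma filt_nlead U i : ~~ lead U i -> filt U i = filt U i.-1.
Proof.
move=> /negPn nl; apply/eqP; rewrite eqEsubv (filtS _ (leq_pred _)) andbT.
by rewrite subv_cap nl capvSl.
Qed.

Lemma upto_sub c1 c2 s : c1 \in upto (f s) -> c2 \in upto (f s) -> c1 s = c2 s ->
  c1 - c2 \in upto (f s).-1.
Proof. by move=> h1 h2 e; rewrite upto_pred memvB //= !ffunE e subrr eqxx. Qed.

Lemma filt_lead U s c : c \in U -> c \in upto (f s) -> c s = 1 ->
  filt U (f s) = (filt U (f s).-1 + <[c]>)%VS.
Proof.
move=> cU cs c1; apply/eqP; rewrite eqEsubv subv_add (filtS _ (leq_pred _)) /=.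
rewrite -memvE memv_cap cU cs !andbT; apply/subvP => x; rewrite memv_cap => /andP[xU xs].
rewrite -(subrK (x s *: c) x) memv_add ?memvZ ?memv_line //.
rewrite memv_cap memvB ?memvZ //= upto_sub ?memvZ //.
by rewrite ffunE c1 [RHS]mulr1.
Qed.

(** Two chains of U with the same last cell differ by a chain of an earlier stage,
which is why the dimension of U grows by at most one. *)
Lemma dim_filt U i : \dim (filt U i) = (\dim (filt U i.-1) + lead U i)%N.
Proof.
have [l|/filt_nlead ->] := boolP (lead U i); last by rewrite addn0.
have [s fs] := lead_cell l; move: l; rewrite -fs => /leadP[c [cU cs c1]].
rewrite (filt_lead cU cs c1) dimv_disjoint_sum ?dim_vline.
  by case: eqP c1 => // ->; rewrite ffunE.
apply/eqP; rewrite -subv0; apply/subvP => x; rewrite !memv_cap upto_pred.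
move=> /andP[/andP[_ /andP[_ /eqP xs]] /vlineP[k xk]]; move: xs; rewrite xk ffunE c1.
by rewrite [_ *: _]mulr1 => ->; rewrite scale0r mem0v.
Qed.

End Filtration.
End Chains.

(** * Persistence modules presented by chains *)

Section Presentation.
Context (E : vectType 'F_2) (M : persistence_module).
Context (Zs Bs : nat -> {vspace E}) (q : forall i, 'Hom(E, pspace M i)).

(** The maps q i exhibit M as the module with spaces Zs i / Bs i and with the
structure maps induced by the inclusions of the Zs i. *)
Record presents : Prop := Presents {
  presents_surj : forall i, (q i @: Zs i)%VS = fullv;
  presents_ker : forall i c, c \in Zs i -> (q i c == 0) = (c \in Bs i);
  presents_sub : forall i, (Bs i <= Zs i)%VS;
  presents_mono : forall i j, (i <= j)%N -> (Zs i <= Zs j)%VS;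
  presents_map : forall i j c, (i <= j)%N -> c \in Zs i -> Defs.pmap M i j (q i c) = q j c
}.

Hypothesis pres : presents.

Lemma presents_elim i (x : pspace M i) : exists2 c, c \in Zs i & x = q i c.
Proof. by apply/memv_imgP; rewrite (presents_surj pres) memvf. Qed.

Lemma pdim_presents i : (\dim (Bs i) + pdim M i)%N = \dim (Zs i).
Proof.
rewrite -(limg_ker_dim (q i) (Zs i)) (presents_surj pres); congr (\dim _ + _)%N.
apply/vspaceP => c; rewrite memv_cap memv_ker.
apply/idP/andP => [cB|[cZ]]; last by rewrite (presents_ker pres).
by have cZ := subvP (presents_sub pres i) _ cB; rewrite (presents_ker pres).
Qed.

Lemma class_diesP b d : (b < d)%N ->
  reflect (exists c, [/\ c \in Zs b, c \in Bs d & c \notin Bs d.-1]) (class_dies M b d).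
Proof.
move=> bd; have bd1 : (b <= d.-1)%N by lia.
have d1d : (d.-1 <= d)%N by lia.
have up c : c \in Zs b -> c \in Zs d.-1 by apply/subvP/(presents_mono pres).
have up' c : c \in Zs b -> c \in Zs d by apply/subvP/(presents_mono pres)/ltnW.
rewrite /class_dies -subv0; apply: (iffP (@subvPn _ _ _ _)) => [[x] | [c [cZ cd cd1]]].
  rewrite memv_cap memv_ker => /andP[/memv_imgP[y _ ->]] + nz0.
  move: nz0; have [c cZ ->] := presents_elim y; rewrite memv0 (presents_map pres) //.
  rewrite (presents_map pres) ?up // !(presents_ker pres) ?up ?up' // => nB Bd.
  by exists c.
exists (q d.-1 c); last by rewrite memv0 (presents_ker pres) ?up.
rewrite memv_cap memv_ker (presents_map pres) ?up // (presents_ker pres) ?up' // cd andbT.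
by apply/memv_imgP; exists (q b c); rewrite ?memvf // (presents_map pres).
Qed.

Lemma limg_pmap_sub b b' n : (b <= n)%N -> (b' <= n)%N ->
  (limg (Defs.pmap M b n) <= limg (Defs.pmap M b' n))%VS = (Zs b <= Zs b' + Bs n)%VS.
Proof.
move=> bn b'n; have up i c : (i <= n)%N -> c \in Zs i -> c \in Zs n.
  by move=> ile; apply/subvP/(presents_mono pres).
apply/subvP/subvP => h x.
  move=> xZ; have /memv_imgP[y _] : Defs.pmap M b n (q b x) \in limg (Defs.pmap M b' n).
    by apply: h; rewrite memv_img ?memvf.
  have [c cZ ->] := presents_elim y; rewrite !(presents_map pres) // => /eqP.
  have xcZ : x - c \in Zs n by apply: memvB; [exact: up bn xZ | exact: up b'n cZ].
  rewrite -subr_eq0 -linearB (presents_ker pres) // => xc.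
  by rewrite -(subrKC c x) memv_add.
case/memv_imgP => y _ ->; have [c cZ ->] := presents_elim y.
have /memv_addP[c1 c1Z [c2 c2B ec]] := h c cZ.
rewrite (presents_map pres) // ec linearD /=.
have /eqP -> : q n c2 == 0.
  by rewrite (presents_ker pres) //; apply: subvP c2B; apply: presents_sub.
by rewrite addr0 -(presents_map pres b'n) // memv_img ?memvf.
Qed.

End Presentation.

Section Births.
Context (X : cell_complex) (f : X -> nat).
Hypotheses (f_inj : injective f) (f_gt0 : forall s, (0 < f s)%N).
Context (W U V : {vspace chain X}) (M : persistence_module).
Context (q : forall i, 'Hom(chain X, pspace M i)).
Hypotheses (UW : (U <= W)%VS) (VW : (V <= W)%VS).

Definition filt_sum i := (filt f U i + filt f V i)%VS.
Hypothesis pres : presents (filt f W) filt_sum q.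

Lemma dim_filt_sum i :
  (\dim (filt_sum i) + \dim (filt f (U :&: V) i))%N = (\dim (filt f U i) + \dim (filt f V i))%N.
Proof.
rewrite -[RHS]dimv_sum_cap; congr (_ + \dim _)%N.
by apply/vspaceP => c; rewrite !memv_cap andbACA andbb.
Qed.

(** The dimension of W / (U + V) is dim W - dim U - dim V + dim (U :&: V). *)
Lemma pdim_step t :
  (pdim M t + (lead f U t + lead f V t) = pdim M t.-1 + (lead f W t + lead f (U :&: V) t))%N.
Proof.
have := pdim_presents pres t; have := pdim_presents pres t.-1.
have := dim_filt_sum t; have := dim_filt_sum t.-1.
rewrite !(dim_filt f_inj f_gt0 _ t); lia.
Qed.

Lemma lead_gt0 T t : lead f T t -> (0 < t)%N.
Proof. by move=> /lead_cell[s <-]. Qed.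

Lemma lead_mono t :
  [/\ lead f U t ==> lead f W t, lead f V t ==> lead f W t,
    lead f (U :&: V) t ==> lead f U t & lead f (U :&: V) t ==> lead f V t].
Proof. by split; apply/implyP; apply: lead_sub; rewrite ?capvSl ?capvSr. Qed.

Lemma birth_lead t : birth M t <-> [&& lead f W t, ~~ lead f U t & ~~ lead f V t].
Proof.
have := @lead_gt0 W t; have := pdim_step t; have := lead_mono t; rewrite /birth.
case: (lead f W t); case: (lead f U t); case: (lead f V t);
  case: (lead f (U :&: V) t) => //= -[] //= _ _ _ _ e t0;
  split => //; try (by case=> ?; lia).
by move=> _; split; [exact: t0 | lia].
Qed.

Lemma death_lead t : death M t <-> [&& lead f U t, lead f V t & ~~ lead f (U :&: V) t].
Proof.
have := @lead_gt0 U t; have := pdim_step t; have := lead_mono t; rewrite /death.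
case: (lead f W t); case: (lead f U t); case: (lead f V t);
  case: (lead f (U :&: V) t) => //= -[] //= _ _ _ _ e t0;
  split => //; try (by case=> ?; lia).
by move=> _; split; [exact: t0 | lia].
Qed.

End Births.

(** * The kernels and the cokernel as presented modules *)

Section Presented.
Context (X : cell_complex).
Implicit Types (S T : {set X}) (c z : chain X).

Definition hclass T : 'Hom(chain X, homology T) :=
  (quot_pi (bounds T) \o linfun (vsproj (cycles T)))%VF.

Lemma hclassE T z : hclass T z = quot_pi (bounds T) (vsproj (cycles T) z).
Proof. by rewrite /hclass comp_lfunE (lfunE (vsproj (cycles T))). Qed.

Lemma quot_pi_elim (E : vectType 'F_2) (U : {vspace E}) (x : quot U) : exists y, x = quot_pi U y.
Proof.
have : x \in limg (quot_pi U) by rewrite quot_pi_surj memvf.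
by case/memv_imgP => y _ ->; exists y.
Qed.

Lemma quot_pi_eq0 (E : vectType 'F_2) (U : {vspace E}) y : (quot_pi U y == 0) = (y \in U).
Proof. by rewrite -memv_ker quot_pi_ker. Qed.

Lemma hclass_elim T (h : homology T) : exists2 z, z \in cycles T & h = hclass T z.
Proof.
have [y ->] := quot_pi_elim h; exists (vsval y); first exact: subvsP.
by rewrite hclassE vsvalK.
Qed.

Lemma hclass_eq0 T z : z \in cycles T ->
  (hclass T z == 0) = (z \in (boundary X @: chains T)%VS).
Proof.
by move=> zT; rewrite hclassE quot_pi_eq0 /bounds -memv_preim (lfunE vsval) /= vsprojK.
Qed.

Lemma cyclesS S T : S \subset T -> (cycles S <= cycles T)%VS.
Proof. by move=> ST; rewrite capvS ?chainsS. Qed.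

Lemma homology_map_hclass S T z : S \subset T -> z \in cycles S ->
  homology_map S T (hclass S z) = hclass T z.
Proof.
move=> ST zS; have im1 : (\1%VF @: cycles S <= cycles T)%VS by rewrite lim1g cyclesS.
have zT := subvP (cyclesS ST) _ zS.
rewrite !hclassE /homology_map quot_mapE.
  congr (quot_pi _ _); apply: val_inj.
  by rewrite /= restr_mapE // id_lfunE /= !vsprojK.
apply/subvP => _ /memv_imgP[y + ->]; rewrite /bounds -!memv_preim !(lfunE vsval) /= restr_mapE //.
by rewrite id_lfunE; apply/subvP/limgS/chainsS.
Qed.

Context (f : X -> nat).
Hypotheses (f_mono : forall t s, face t s -> (f t <= f s)%N).

Lemma sublevel_sub i : subcomplex (sublevel f i).
Proof. by move=> t s /f_mono ts; rewrite !inE; apply: leq_trans. Qed.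

Lemma sublevelS i j : (i <= j)%N -> sublevel f i \subset sublevel f j.
Proof. by move=> ij; apply/subsetP => s; rewrite !inE => /leq_trans; apply. Qed.

Lemma mem_ker_space S i z : z \in cycles (S :&: sublevel f i) ->
  (hclass (S :&: sublevel f i) z \in ker_space f S i) = (z \in (boundary X @: upto f i)%VS).
Proof.
move=> zS; rewrite /ker_space /homology_ker memv_ker.
rewrite homology_map_hclass ?subsetIr // hclass_eq0 //.
by apply: subvP zS; rewrite cyclesS ?subsetIr.
Qed.

Definition ker_class S i : 'Hom(chain X, subvs_of (ker_space f S i)) :=
  (linfun (vsproj (ker_space f S i)) \o hclass (S :&: sublevel f i) \o boundary X)%VF.

Lemma boundary_cycles S i c : c \in filt f (relcycles S) i ->
  boundary X c \in cycles (S :&: sublevel f i).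
Proof.
rewrite memv_cap mem_relcycles => /andP[cS ci].
rewrite memv_cap chainsI memv_cap cS boundary_chains //=; last exact: sublevel_sub.
by rewrite memv_ker boundary_boundary.
Qed.

Lemma ker_classE S i c : c \in filt f (relcycles S) i ->
  vsval (ker_class S i c) = hclass (S :&: sublevel f i) (boundary X c).
Proof.
move=> cS; rewrite /ker_class comp_lfunE comp_lfunE (lfunE (vsproj _)) /= vsprojK //.
by rewrite mem_ker_space ?boundary_cycles // memv_img //; move: cS; rewrite memv_cap => /andP[].
Qed.

Lemma ker_map_class S T i j c : S \subset T -> (i <= j)%N ->
  c \in filt f (relcycles S) i -> ker_map f S T i j (ker_class S i c) = ker_class T j c.
Proof.
move=> ST ij cS.
have cT : c \in filt f (relcycles T) j.
  by apply: subvP cS; rewrite capvS ?relcyclesS ?uptoS.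
have sub : S :&: sublevel f i \subset T :&: sublevel f j by rewrite setISS ?sublevelS.
apply: val_inj; rewrite /= restr_mapE.
  by rewrite !ker_classE // homology_map_hclass ?boundary_cycles.
apply/subvP => _ /memv_imgP[y + ->]; have [z zS ->] := hclass_elim y.
rewrite mem_ker_space // homology_map_hclass // mem_ker_space.
  by apply/subvP/limgS/uptoS.
by apply: subvP zS; exact: cyclesS.
Qed.

Lemma ker_class_surj S i : (ker_class S i @: filt f (relcycles S) i)%VS = fullv.
Proof.
apply/vspaceP => x; rewrite memvf; apply/memv_imgP.
have [z zS hz] := hclass_elim (vsval x).
have := subvsP x; rewrite hz mem_ker_space // => /memv_imgP[c ci zc].
have cS : c \in filt f (relcycles S) i.
  rewrite memv_cap ci andbT mem_relcycles -zc.
  by move: zS; rewrite memv_cap chainsI memv_cap -andbA => /andP[].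
by exists c => //; apply: val_inj; rewrite /= ker_classE // hz zc.
Qed.

(** If c has the same boundary as a chain a of S, then c - a is a cycle. *)
Lemma ker_class_eq0 S i c : subcomplex S -> c \in filt f (relcycles S) i ->
  (ker_class S i c == 0) = (c \in filt f (chains S) i + filt f (lker (boundary X)) i)%VS.
Proof.
move=> subS cS; rewrite -(inj_eq val_inj) /= ker_classE // hclass_eq0 ?boundary_cycles //.
have ci : c \in upto f i by move: cS; rewrite memv_cap => /andP[].
apply/memv_imgP/memv_addP => [[a]|[a aS [z]]].
  rewrite chainsI => aS e; exists a => //; exists (c - a); last by rewrite addrC subrK.
  have ai : a \in upto f i by move: aS; rewrite memv_cap => /andP[].
  by rewrite memv_cap memv_ker linearB /= e subrr eqxx memvB.
rewrite memv_cap memv_ker => /andP[/eqP z0 _] ->; exists a; first by rewrite chainsI.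
by rewrite linearD /= z0 addr0.
Qed.

Lemma Ker_presents S : subcomplex S ->
  presents (M := Ker_module f S) (filt f (relcycles S))
    (filt_sum f (chains S) (lker (boundary X))) (ker_class S).
Proof.
move=> subS; split => /=.
- exact: ker_class_surj.
- by move=> i c; exact: ker_class_eq0.
- move=> i; rewrite subv_add !filtSl ?lker_relcycles //.
  exact: chains_relcycles.
- by move=> i j ij; apply: filtS.
- by move=> i j c ij; apply: ker_map_class.
Qed.

Context (A B : {set X}).
Hypotheses (subA : subcomplex A) (subB : subcomplex B).

Lemma subcomplexU : subcomplex (A :|: B).
Proof. by move=> t s ts; rewrite !inE => /orP[/(subA ts)|/(subB ts)] ->; rewrite ?orbT. Qed.

Lemma filt_chainsU i :
  (filt f (chains (A :|: B)) i <= filt_sum f (relcycles A) (relcycles B) i)%VS.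
Proof.
rewrite /filt /upto -chainsI setIUl chainsU !chainsI.
by rewrite addvS // capvS // chains_relcycles.
Qed.

Definition cok_class i : 'Hom(chain X, quot (limg (Phi f A B i))) :=
  (quot_pi (limg (Phi f A B i)) \o ker_class (A :|: B) i)%VF.

Lemma cok_classE i c :
  cok_class i c = quot_pi (limg (Phi f A B i)) (ker_class (A :|: B) i c).
Proof. by rewrite /cok_class comp_lfunE. Qed.

(** The map under [linfun] in [Phi] is repeated here to give it a structure of
linear map, without which nothing is known about [linfun]. *)
Definition Phi_fun i (p : subvs_of (ker_space f A i) * subvs_of (ker_space f B i)) :
    subvs_of (ker_space f (A :|: B) i) :=
  ker_map f A (A :|: B) i i p.1 + ker_map f B (A :|: B) i i p.2.

Fact Phi_fun_is_linear i : linear (@Phi_fun i).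
Proof. by move=> a p p'; rewrite /Phi_fun /= !linearP /= scalerDr addrACA. Qed.

HB.instance Definition _ i :=
  GRing.isLinear.Build 'F_2 _ _ _ (@Phi_fun i) (@Phi_fun_is_linear i).

Lemma PhiE i p : Phi f A B i p = ker_map f A (A :|: B) i i p.1 + ker_map f B (A :|: B) i i p.2.
Proof. exact: (lfunE (@Phi_fun i)). Qed.

Lemma Phi_limgP i c : c \in filt f (relcycles (A :|: B)) i ->
  (ker_class (A :|: B) i c \in limg (Phi f A B i))
    = (c \in filt_sum f (relcycles A) (relcycles B) i).
Proof.
move=> cP; apply/memv_imgP/memv_addP => [[p _ /eqP]|[a aA [b bB ec]]].
  have /memv_imgP[a aA pa] : p.1 \in (ker_class A i @: filt f (relcycles A) i)%VS.
    by rewrite ker_class_surj memvf.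
  have /memv_imgP[b bB pb] : p.2 \in (ker_class B i @: filt f (relcycles B) i)%VS.
    by rewrite ker_class_surj memvf.
  rewrite PhiE pa pb !ker_map_class ?subsetUl ?subsetUr // -linearD -subr_eq0 -linearB.
  have aP : a \in filt f (relcycles (A :|: B)) i.
    by apply: subvP aA; rewrite capvS ?relcyclesS ?subsetUl.
  have bP : b \in filt f (relcycles (A :|: B)) i.
    by apply: subvP bB; rewrite capvS ?relcyclesS ?subsetUr.
  have dP : c - (a + b) \in filt f (relcycles (A :|: B)) i by rewrite memvB ?memvD.
  rewrite ker_class_eq0 //; last exact: subcomplexU.
  move=> h; apply/memv_addP; rewrite -(subrK (a + b) c).
  apply: memvD; last by rewrite memv_add.
  apply: subvP h; rewrite subv_add; apply/andP; split.
    exact: filt_chainsU.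
  by apply: subv_trans (addvSl _ _); rewrite filtSl ?lker_relcycles.
exists (ker_class A i a, ker_class B i b); first exact: memvf.
by rewrite PhiE /= !ker_map_class ?subsetUl ?subsetUr // ec linearD.
Qed.

Lemma Cok_presents :
  presents (M := Cok_Phi_module f A B) (filt f (relcycles (A :|: B)))
    (filt_sum f (relcycles A) (relcycles B)) cok_class.
Proof.
split => /=.
- move=> i; apply/vspaceP => x; rewrite memvf.
  have [y ->] := quot_pi_elim x.
  have : y \in (ker_class (A :|: B) i @: filt f (relcycles (A :|: B)) i)%VS.
    by rewrite ker_class_surj memvf.
  case/memv_imgP => c cP ->; apply/memv_imgP; exists c => //.
  by rewrite cok_classE.
- by move=> i c cP; rewrite cok_classE quot_pi_eq0 Phi_limgP.
- move=> i; rewrite subv_add !filtSl //; apply: relcyclesS; [exact: subsetUr | exact: subsetUl].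
- by move=> i j ij; apply: filtS.
- move=> i j c ij cP; rewrite !cok_classE quot_mapE ?ker_map_class //.
  apply/subvP => _ /memv_imgP[y /[swap] -> yP].
  have : y \in (ker_class (A :|: B) i @: filt f (relcycles (A :|: B)) i)%VS.
    by rewrite ker_class_surj memvf.
  case/memv_imgP => d dP ed; move: yP; rewrite ed ker_map_class //.
  rewrite !Phi_limgP //; last by apply: subvP dP; exact: filtS.
  by apply/subvP/addvS; apply: filtS.
Qed.

End Presented.

(** * Column reduction *)

Lemma addv_line_eq (K : fieldType) (E : vectType K) (U : {vspace E}) (x y : E) :
  x - y \in U -> (U + <[x]> = U + <[y]>)%VS.
Proof.
have half (a b : E) : a - b \in U -> (U + <[a]> <= U + <[b]>)%VS.
  move=> abU; rewrite subv_add addvSl -memvE -(subrK b a).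
  by rewrite memv_add ?memv_line.
move=> xyU; apply/eqP; rewrite eqEsubv !half //.
by rewrite -opprB memvN.
Qed.

Lemma span_rcons (K : fieldType) (E : vectType K) (s : seq E) x :
  (<<rcons s x>> = <<s>> + <[x]>)%VS.
Proof. by rewrite -cats1 span_cat span_seq1. Qed.

Section Low.
Context (X : cell_complex) (rho : X -> nat).
Hypothesis rho_inj : injective rho.
Implicit Types c : chain X.

Lemma low_some c s : low rho c = Some s <->
  c s != 0 /\ forall t, c t != 0 -> (rho t <= rho s)%N.
Proof.
rewrite /low; case: pickP => [s' /andP[cs' /forall_inP max'] | none].
  split=> [[<-] // | [cs max]]; congr Some; apply: rho_inj.
  by apply/eqP; rewrite eqn_leq max ?max'.
split=> // -[cs max]; have := none s; rewrite cs /= => /forall_inP[].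
exact: max.
Qed.

Lemma low_none c : low rho c = None <-> c = 0.
Proof.
split=> [|->]; last first.
  by case e: (low rho 0) => [s|//]; case/low_some: e; rewrite ffunE eqxx.
rewrite /low; case: pickP => // none _; apply/ffunP => s; rewrite ffunE.
apply/eqP/negPn/negP => cs; case: (@arg_maxnP _ s (fun s => c s != 0) rho cs) => t ct max.
by have := none t; rewrite ct => /forall_inP[].
Qed.

Lemma low_exists c : c != 0 -> exists s, low rho c = Some s.
Proof. by case e: (low rho c) => [s|]; [exists s | move/low_none: e => ->; rewrite eqxx]. Qed.

Lemma low_add_neq c c' s s' : low rho c = Some s -> low rho c' = Some s' -> s != s' ->
  low rho (c + c') = Some (if (rho s < rho s')%N then s' else s).
Proof.
move=> /low_some[cs max] /low_some[cs' max'] ss'; apply/low_some.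
have ne : rho s != rho s' by apply: contraNneq ss' => /rho_inj ->.
have add t : (c + c') t != 0 -> (c t != 0) || (c' t != 0).
  by rewrite ffunE; apply: contraNT; rewrite negb_or !negbK => /andP[/eqP-> /eqP->]; rewrite addr0.
case: ltngtP ne => // lt _; split.
- rewrite ffunE (_ : c s' = 0) ?add0r //; apply/eqP/negPn/negP => /max; by rewrite leqNgt lt.
- move=> t /add /orP[/max le|/max' //]; exact: leq_trans le (ltnW lt).
- rewrite ffunE (_ : c' s = 0) ?addr0 //; apply/eqP/negPn/negP => /max'; by rewrite leqNgt lt.
- move=> t /add /orP[/max //|/max' le]; exact: leq_trans le (ltnW lt).
Qed.

Section Reduction.
Context (W : vectType 'F_2) (col : {linear W -> chain X}).
Implicit Types (left D : seq W) (w v u : W).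

(** The columns that may be added to w; the reduction step uses the first one. *)
Definition clashes left w :=
  [seq w' <- left | (col w != 0) && (low rho (col w') == low rho (col w))].

Definition height c : nat :=
  if low rho c is Some s then #|[set t | (rho t <= rho s)%N]| else 0.

(** Adding a column with the same lowest 1 cancels that 1 and only touches rows
above it. *)
Lemma reduce_step_height left w : clashes left w != [::] ->
  (height (col (reduce_step rho col left w)) < height (col w))%N.
Proof.
rewrite /reduce_step -/(clashes left w); case e: (clashes left w) => [//|w' l] _.
have : w' \in clashes left w by rewrite e mem_head.
rewrite mem_filter => /andP[/andP[nz /eqP lw] _].
have [s ls] := low_exists nz; rewrite /height ls.
have [/F2_neq0 cs max] := (low_some _ _).1 ls.
have [/F2_neq0 cs' max'] := (low_some _ _).1 (etrans lw ls).
case e': low => [s'|]; last by apply/card_gt0P; exists s; rewrite inE.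
have [] := (low_some _ _).1 e'; rewrite linearD ffunE => nz' _.
have lt : (rho s' < rho s)%N.
  rewrite ltn_neqAle; apply/andP; split.
    by apply: contraNneq nz' => /rho_inj ->; rewrite cs cs'; apply/eqP/val_inj.
  have [/eqP h|/max //] := boolP (col w s' == 0).
  by apply: max'; move: nz'; rewrite h add0r.
apply: proper_card; apply/properP; split; last by exists s; rewrite !inE // -ltnNge.
by apply/subsetP => t; rewrite !inE => /leq_trans; apply; exact: ltnW.
Qed.

Lemma height_le c : (height c <= #|X|)%N.
Proof. by rewrite /height; case: low => // s; apply: max_card. Qed.

(** The height is at most the number of rows, so this number of steps is enough
for the loop to stop. *)
Lemma reduce_column_clashes left w : clashes left (reduce_column rho col left w) = [::].
Proof.
rewrite /reduce_column; move: (height_le (col w)); move: #|X| => n.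
elim: n w => [|n IHn] w hw.
  apply/eqP; apply: contraTT hw => /reduce_step_height h; rewrite -ltnNge.
  exact: leq_ltn_trans h.
rewrite iterSr; have [e|/reduce_step_height h] := eqVneq (clashes left w) [::].
  have fixw : reduce_step rho col left w = w by rewrite /reduce_step -/(clashes left w) e.
  by rewrite fixw; elim: n {IHn hw} => // n IHn; rewrite iterSr fixw.
by apply: IHn; rewrite -ltnS; exact: leq_trans h hw.
Qed.

Lemma reduce_column_sub left w : reduce_column rho col left w - w \in <<left>>%VS.
Proof.
rewrite /reduce_column; elim: #|X| => [|n IHn] /=; first by rewrite subrr mem0v.
set v := iter n _ w in IHn *; rewrite /reduce_step -/(clashes left v).
case e: (clashes left v) => [//|w' l].
rewrite addrAC memvD // memv_span //.
have : w' \in clashes left v by rewrite e mem_head.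
by rewrite mem_filter => /andP[].
Qed.

Lemma column_reduction_rcons D w : column_reduction rho col (rcons D w) =
  rcons (column_reduction rho col D) (reduce_column rho col (column_reduction rho col D) w).
Proof. by rewrite /column_reduction -cats1 foldl_cat. Qed.

Lemma span_column_reduction D : <<column_reduction rho col D>>%VS = <<D>>%VS.
Proof.
elim/last_ind: D => // D w IHD; rewrite column_reduction_rcons !span_rcons -IHD.
by apply: addv_line_eq; exact: reduce_column_sub.
Qed.

(** In a sum of columns with distinct lowest 1s, the lowest of these 1s cannot
cancel. *)
Lemma low_span_reduced D v : v \in <<D>>%VS -> col v != 0 ->
  exists2 w, w \in column_reduction rho col D & low rho (col w) = low rho (col v).
Proof.
elim/last_ind: D v => [|D w IHD] v.
  by rewrite span_nil memv0 => /eqP ->; rewrite linear0 eqxx.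
rewrite -span_column_reduction column_reduction_rcons span_rcons span_column_reduction.
set L := column_reduction _ _ D in IHD *; set r := reduce_column _ _ _ _.
case/memv_addP => v1 v1D [_ /vlineP[k ->] ->].
have [-> nz|/F2_neq0 ->] := eqVneq k 0.
  rewrite scale0r addr0 in nz *; have [w' w'L <-] := IHD v1 v1D nz.
  by exists w' => //; rewrite mem_rcons inE w'L orbT.
rewrite scale1r linearD => nz.
have [v10|v10] := eqVneq (col v1) 0.
  by exists r; rewrite ?mem_rcons ?mem_head // v10 add0r.
have [w' w'L lw'] := IHD v1 v1D v10.
have w'Lr : w' \in rcons L r by rewrite mem_rcons inE w'L orbT.
have [r0|r0] := eqVneq (col r) 0; first by exists w' => //; rewrite r0 addr0.
have [s ls] := low_exists v10; have [s' ls'] := low_exists r0.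
have ss' : s != s'.
  apply: contra_eq_neq (reduce_column_clashes L w) => /= ss'.
  rewrite -has_filter; apply/hasP; exists w' => //.
  by rewrite -/r r0 lw' ls ls' ss' /=.
rewrite (low_add_neq ls ls' ss'); case: ifP => _.
  by exists r; rewrite ?mem_rcons ?mem_head.
by exists w' => //; rewrite lw'.
Qed.

(** A competitor u differs from the reduced column by a combination of the columns
to its left, whose lowest 1 is in another row than that of the reduced column, so
the sum keeps the lower of the two. *)
Lemma reduced_low_min D w u s :
  low rho (col (reduce_column rho col (column_reduction rho col D) w)) = Some s ->
  u - w \in <<D>>%VS -> exists2 t, col u t != 0 & (rho s <= rho t)%N.
Proof.
set L := column_reduction _ _ D; set r := reduce_column _ _ _ _ => ls uD.
have vD : u - r \in <<D>>%VS.
  rewrite -(subrKA w) memvD // -opprB memvN -span_column_reduction.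
  exact: reduce_column_sub.
have r0 : col r != 0 by apply/eqP => /low_none; rewrite ls.
rewrite -(subrKC r u) linearD.
have [v0|v0] := eqVneq (col (u - r)) 0.
  by exists s => //; rewrite v0 addr0; case/low_some: ls.
have [s' ls'] := low_exists v0.
have [w' w'L lw'] := low_span_reduced vD v0.
have ss' : s != s'.
  apply: contra_eq_neq (reduce_column_clashes L w) => /= ss'.
  rewrite -has_filter; apply/hasP; exists w' => //.
  by rewrite -/r r0 lw' ls ls' ss' /=.
have /low_some[nz _] := low_add_neq ls ls' ss'.
by eexists; [exact: nz | case: ltnP => // /ltnW].
Qed.

Lemma column_reduction_cat D1 w D2 : exists R2,
  column_reduction rho col (D1 ++ w :: D2) =
  column_reduction rho col D1 ++ reduce_column rho col (column_reduction rho col D1) w :: R2.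
Proof.
elim/last_ind: D2 => [|D2 w' [R2 IH]].
  by exists [::]; rewrite cats1 column_reduction_rcons cats1.
rewrite -rcons_cons -rcons_cat column_reduction_rcons IH.
by eexists; rewrite rcons_cat rcons_cons.
Qed.

Lemma size_column_reduction D : size (column_reduction rho col D) = size D.
Proof.
by elim/last_ind: D => // D w IH; rewrite column_reduction_rcons !size_rcons IH.
Qed.

End Reduction.
End Low.

(** * The image matrices *)

Section BoundaryPair.
Context (X : cell_complex).

Definition boundary_pair (c : chain X) : (chain X * chain X)%type := (boundary X c, c).

Fact boundary_pair_is_linear : linear boundary_pair.
Proof. by move=> a c c'; rewrite /boundary_pair linearP. Qed.

HB.instance Definition _ :=
  GRing.isLinear.Build 'F_2 _ _ _ boundary_pair boundary_pair_is_linear.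

End BoundaryPair.

Section ImageMatrices.
Context (X : cell_complex) (N : nat) (f : X -> nat).
Hypotheses (f_inj : injective f) (f_gt0 : forall s, (0 < f s)%N) (f_le : forall s, (f s <= N)%N).
Implicit Types (S : {set X}) (c : chain X) (tau : X).

Lemma cells_split tau : exists s1 s2, [/\ cells f = s1 ++ tau :: s2, tau \notin s1,
   tau \notin s2, uniq s1 & forall s, (s \in s1) = (f s < f tau)%N].
Proof.
have Ucells : uniq (cells f) by rewrite sort_uniq enum_uniq.
have Mcells s : s \in cells f by rewrite mem_sort mem_enum.
have tr : transitive (relpre f leq) by move=> ? ? ?; apply: leq_trans.
have : pairwise (relpre f leq) (cells f).
  by rewrite -sorted_pairwise //; apply: sort_sorted => ? ?; apply: leq_total.
have [s1 [s2 e]] : exists s1 s2, cells f = s1 ++ tau :: s2.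
  by case/splitPr: (Mcells tau) => s1 s2; exists s1, s2.
rewrite e pairwise_cat /= => /and3P[s1le _ /andP[s2le _]].
move: Ucells; rewrite e cat_uniq /= => /and3P[U1 ]; rewrite negb_or => /andP[t1 _] /andP[t2 _].
exists s1, s2; split=> // s.
apply/idP/idP => [ss1 | lt].
  have := allP (allP s1le s ss1) tau; rewrite mem_head => /(_ isT) /= le.
  rewrite ltn_neqAle le andbT; apply: contraNneq t1 => /f_inj <- //.
have := Mcells s; rewrite e mem_cat inE => /or3P[//|/eqP st|/(allP s2le) /=].
  by rewrite st ltnn in lt.
by rewrite leqNgt lt.
Qed.

Lemma span_cells_before tau s1 : uniq s1 -> (forall s, (s \in s1) = (f s < f tau)%N) ->
  <<[seq cell_chain s | s <- s1]>>%VS = upto f (f tau).-1.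
Proof.
move=> U1 s1E; rewrite span_def big_map big_uniq //; apply: eq_bigl => s.
rewrite s1E inE; move: (f_gt0 tau); by case: (f tau).
Qed.

Lemma cell_chain_upto tau : cell_chain tau \in upto f (f tau).
Proof. by rewrite mem_cell_chain inE. Qed.

Lemma sub_cell_chain tau c :
  (c - cell_chain tau \in upto f (f tau).-1) = (c \in upto f (f tau)) && (c tau == 1).
Proof.
rewrite upto_pred // !ffunE eqxx subr_eq0; congr (_ && _).
apply/idP/idP => h; last by rewrite memvB ?cell_chain_upto.
by rewrite -(subrK (cell_chain tau) c) memvD ?cell_chain_upto.
Qed.

Lemma im_order_inj S : injective (im_order N f S).
Proof.
move=> s t; rewrite /im_order; case: ifP => _; case: ifP => _; first exact: f_inj.
- by move=> e; have := f_le s; rewrite e leqNgt -addn1 leq_add2l f_gt0.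
- by move=> e; have := f_le t; rewrite -e leqNgt -addn1 leq_add2l f_gt0.
- by move/addnI/f_inj.
Qed.

(** The columns left of tau are the pairs (boundary of c, c) with c a cell that
enters before tau. *)
Lemma nth_RV_Im S tau : exists D1 : seq (chain X * chain X),
  (R_Im N f S tau, V_Im N f S tau) = reduce_column (im_order N f S) fst
     (column_reduction (im_order N f S) fst D1) (boundary_pair (cell_chain tau))
  /\ <<D1>>%VS = (linfun (@boundary_pair X) @: upto f (f tau).-1)%VS.
Proof.
have [s1 [s2 [e t1 t2 U1 s1E]]] := cells_split tau.
exists [seq boundary_pair (cell_chain s) | s <- s1]; split; last first.
  rewrite -(span_cells_before U1 s1E) limg_span -map_comp; congr <<_>>%VS.
  by apply: eq_map => s; rewrite /= lfunE.
rewrite /R_Im /V_Im -surjective_pairing /RV_Im e map_cat /=.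
have [R2 ->] := column_reduction_cat (im_order N f S) (@fst (chain X) (chain X))
  [seq boundary_pair (cell_chain s) | s <- s1] (boundary_pair (cell_chain tau))
  [seq boundary_pair (cell_chain s) | s <- s2].
rewrite nth_cat size_column_reduction size_map index_cat (negPf t1) /= eqxx addn0.
by rewrite ltnn subnn.
Qed.

Lemma RV_Im_sub S tau : exists2 c, c \in upto f (f tau).-1 &
  (R_Im N f S tau, V_Im N f S tau) = boundary_pair (c + cell_chain tau).
Proof.
have [D1 [e sp]] := nth_RV_Im S tau.
have := reduce_column_sub (im_order N f S) (@fst (chain X) (chain X))
  (column_reduction (im_order N f S) fst D1) (boundary_pair (cell_chain tau)).
rewrite -e span_column_reduction sp => /memv_imgP[c cu]; rewrite lfunE => ec.
by exists c => //; rewrite linearD -ec subrK.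
Qed.

Lemma V_Im_sub S tau : V_Im N f S tau - cell_chain tau \in upto f (f tau).-1.
Proof. by have [c cu [_ ->]] := RV_Im_sub S tau; rewrite addrK. Qed.

Lemma R_ImE S tau : R_Im N f S tau = boundary X (V_Im N f S tau).
Proof. by have [c _ [-> ->]] := RV_Im_sub S tau. Qed.

(** The chains with last cell tau are those that differ from tau by earlier cells,
so R[tau] has the smallest lowest 1 among their boundaries. *)
Lemma R_Im_low_min S tau s c : low (im_order N f S) (R_Im N f S tau) = Some s ->
  c - cell_chain tau \in upto f (f tau).-1 ->
  exists2 t, boundary X c t != 0 & (im_order N f S s <= im_order N f S t)%N.
Proof.
have [D1 [e sp]] := nth_RV_Im S tau => ls cu.
apply: (reduced_low_min (im_order_inj (S := S)) (col := fst) (D := D1)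
  (w := boundary_pair (cell_chain tau)) (u := boundary_pair c)).
  by rewrite -e.
by rewrite sp; apply/memv_imgP; exists (c - cell_chain tau); rewrite ?lfunE ?linearB.
Qed.

Lemma V_Im_lead S tau : V_Im N f S tau \in upto f (f tau) /\ V_Im N f S tau tau = 1.
Proof. by have := V_Im_sub S tau; rewrite sub_cell_chain => /andP[? /eqP]. Qed.

Lemma R_Im_eq0 S tau : (R_Im N f S tau == 0) = lead f (lker (boundary X)) (f tau).
Proof.
have [Vu V1] := V_Im_lead S tau.
apply/idP/leadP => // [R0 | [c [cZ cu c1]]].
  by exists (V_Im N f S tau); rewrite memv_ker -R_ImE.
apply/negPn/negP => /(low_exists (im_order_inj (S := S)))[s ls].
have [|t] := R_Im_low_min ls (c := c); first by rewrite sub_cell_chain cu c1 /=.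
by move: cZ; rewrite memv_ker => /eqP ->; rewrite ffunE eqxx.
Qed.

(** The rows of S come first in the order of the image matrix of S, so the lowest 1
of a column is in S exactly when the whole column is. *)
Lemma im_order_le S s t : s \in S ->
  (im_order N f S t <= im_order N f S s)%N -> t \in S.
Proof.
rewrite /im_order => ->; apply: contraLR => /negPf ->; rewrite -ltnNge.
by rewrite -addn1 leq_add ?f_gt0.
Qed.

Lemma low_in_R_Im S tau : low_in (im_order N f S) S (R_Im N f S tau) =
  lead f (relcycles S) (f tau) && ~~ lead f (lker (boundary X)) (f tau).
Proof.
have [Vu V1] := V_Im_lead S tau.
rewrite /low_in -(R_Im_eq0 S).
case e: low => [s|]; last by move/(low_none (im_order_inj (S := S))): e => ->; rewrite eqxx andbF.
have /(low_some (im_order_inj (S := S)))[Rs max] := e.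
have -> : R_Im N f S tau != 0 by apply: contraNneq Rs => ->; rewrite ffunE.
rewrite andbT; apply/idP/leadP => // [sS | [c [cS cu c1]]].
  exists (V_Im N f S tau); split=> //; rewrite mem_relcycles -R_ImE.
  by apply/chainsP => t /max; apply: im_order_le.
have [|t ct] := R_Im_low_min e (c := c); first by rewrite sub_cell_chain cu c1 /=.
have tS : t \in S by move: cS; rewrite mem_relcycles => /chainsP; apply.
exact: im_order_le.
Qed.

Lemma V_Im_relcycles S tau : lead f (relcycles S) (f tau) -> V_Im N f S tau \in relcycles S.
Proof.
move=> lS; rewrite mem_relcycles -R_ImE.
have [|lZ] := boolP (lead f (lker (boundary X)) (f tau)).
  by rewrite -(R_Im_eq0 S) => /eqP ->; rewrite mem0v.
have : low_in (im_order N f S) S (R_Im N f S tau) by rewrite low_in_R_Im lS.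
rewrite /low_in; case e: low => [s|//] sS.
have /(low_some (im_order_inj (S := S)))[Rs max] := e.
by apply/chainsP => t /max; apply: im_order_le.
Qed.

End ImageMatrices.

(** * The matrix of the cokernel *)

Lemma addv_interchange (K : fieldType) (E : vectType K) (U V U' V' : {vspace E}) :
  (U + V + (U' + V') = U + U' + (V + V'))%VS.
Proof. by rewrite -!addvA; congr (_ + _)%VS; rewrite !addvA [(V + _)%VS]addvC. Qed.

Lemma leq_pred_lt b d : (b < d)%N -> (b <= d.-1)%N.
Proof. by case: d. Qed.

Section PhiMatrix.
Context (X : cell_complex) (N : nat) (f : X -> nat).
Hypotheses (f_inj : injective f) (f_gt0 : forall s, (0 < f s)%N) (f_le : forall s, (f s <= N)%N).
Context (A B : {set X}).
Hypotheses (subA : subcomplex A) (subB : subcomplex B) (disjAB : [disjoint A & B]).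

Local Notation ZX := (lker (boundary X)).
Local Notation PA := (relcycles A).
Local Notation PB := (relcycles B).
Local Notation L := (filt_sum f PA PB).
Local Notation VA := (V_Im N f A).
Local Notation VB := (V_Im N f B).

(** The death criterion of [death_lead] for the cokernel; the two columns of the
matrix turn out to sit at these times, see [double_columnE]. *)
Definition is_double i := [&& lead f PA i, lead f PB i & ~~ lead f ZX i].

Lemma phi_columnsE tau :
  let colA := if lead f PA (f tau) then [:: VA tau] else [::] in
  phi_columns N f A B tau =
  if lead f PB (f tau) && ~~ lead f ZX (f tau) then
    if tau \in A then rcons colA (VB tau) else VB tau :: colA
  else colA.
Proof.
rewrite /phi_columns !low_in_R_Im // R_Im_eq0 //.
have := @lead_sub X f ZX PA (f tau) (lker_relcycles A).
by case: (lead f ZX _) => [-> //|_]; case: (lead f PA _).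
Qed.

Lemma phi_columns_lead tau c : c \in phi_columns N f A B tau ->
  c \in upto f (f tau) /\ c tau = 1.
Proof.
have hA := V_Im_lead N f_inj f_gt0 A tau; have hB := V_Im_lead N f_inj f_gt0 B tau.
rewrite phi_columnsE; case: ifP => _; case: ifP => _; try case: ifP => _;
  by rewrite ?inE //=; try (case/orP); move/eqP ->.
Qed.

Lemma filt_sumS i j : (i <= j)%N -> (L i <= L j)%VS.
Proof. by move=> ij; apply: addvS; apply: filtS. Qed.

Lemma filt_sum_upto i : (L i <= upto f i)%VS.
Proof. by rewrite subv_add !capvSr. Qed.

Lemma filt_V_Im S tau : lead f (relcycles S) (f tau) ->
  filt f (relcycles S) (f tau) = (filt f (relcycles S) (f tau).-1 + <[V_Im N f S tau]>)%VS.
Proof.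
move=> lS; have [? ?] := V_Im_lead N f_inj f_gt0 S tau.
by apply: filt_lead => //; exact: V_Im_relcycles.
Qed.

(** If tau is last in a cycle then it is so in P^A and in P^B, with the same chain;
this is why only one column is listed in that case. *)
Lemma span_phi_columns tau :
  (L (f tau).-1 + <<phi_columns N f A B tau>>)%VS = L (f tau).
Proof.
rewrite phi_columnsE /= {2}/filt_sum.
have := @lead_sub X f ZX PA (f tau) (lker_relcycles A).
have := @lead_sub X f ZX PB (f tau) (lker_relcycles B).
have [lZ /(_ isT) lB /(_ isT) lA|nZ _ _] := boolP (lead f ZX (f tau)).
  rewrite lA lB /= span_seq1 (filt_V_Im lA).
  have [? ?] := V_Im_lead N f_inj f_gt0 A tau.
  have VZ : VA tau \in ZX by rewrite memv_ker -R_ImE // R_Im_eq0.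
  rewrite (@filt_lead X f f_inj f_gt0 PB tau (VA tau)) //; last first.
    by apply: subvP VZ; exact: lker_relcycles.
  by rewrite addv_interchange addvv.
rewrite andbT.
have [lA|/filt_nlead->] := boolP (lead f PA (f tau));
  have [lB|/filt_nlead->] := boolP (lead f PB (f tau)).
- rewrite (filt_V_Im lA) (filt_V_Im lB) addv_interchange; case: ifP => _.
    by rewrite span_rcons span_seq1.
  by rewrite span_cons span_seq1 [(<[VB _]> + _)%VS]addvC.
- by rewrite (filt_V_Im lA) span_seq1 -!addvA; congr (_ + _)%VS; rewrite addvC.
- by rewrite (filt_V_Im lB) /= if_same span_seq1 addvA.
- by rewrite span_nil addv0.
Qed.

Lemma sum_phi_columns i : (\sum_(s | (f s <= i)%N) <<phi_columns N f A B s>>)%VS = L i.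
Proof.
elim: i => [|i IHi].
  rewrite big_pred0 => [|s]; last by rewrite leqNgt f_gt0.
  apply/esym/eqP; rewrite -subv0; apply: subv_trans (filt_sum_upto 0) _.
  apply/subvP => c /uptoP c0; rewrite memv0; apply/eqP/ffunP => s; rewrite ffunE.
  by apply/eqP/negPn/negP => /c0; rewrite leqNgt f_gt0.
have [s /eqP fs|none] := pickP (fun s => f s == i.+1).
  have -> : L i.+1 = (L i + <<phi_columns N f A B s>>)%VS by rewrite -fs -span_phi_columns fs.
  rewrite (bigD1 s) /= ?fs // addvC -IHi; congr (_ + _)%VS.
  by apply: eq_bigl => t; rewrite -(inj_eq f_inj) fs andbC -ltn_neqAle ltnS.
have nl U : ~~ lead f U i.+1.
  by apply/negP => /lead_cell[s fs]; move: (none s); rewrite fs eqxx.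
rewrite /filt_sum (filt_nlead (nl PA)) (filt_nlead (nl PB)) /= -/(L i) -IHi.
by apply: eq_bigl => s; rewrite leq_eqVlt (none s) ltnS.
Qed.

Lemma phi_columns_before tau (s1 : seq X) :
  uniq s1 -> (forall s, (s \in s1) = (f s < f tau)%N) ->
  <<flatten [seq phi_columns N f A B s | s <- s1]>>%VS = L (f tau).-1.
Proof.
move=> U1 s1E; rewrite -sum_phi_columns.
transitivity (\sum_(s <- s1) <<phi_columns N f A B s>>)%VS.
  by elim: (s1) => [|s s1' IH] /=; rewrite ?span_nil ?big_nil // big_cons span_cat IH.
rewrite big_uniq //; apply: eq_bigl => s; rewrite s1E.
by move: (f_gt0 tau); case: (f tau).
Qed.

Lemma D_Phi_split tau : exists E1 E2, [/\
  D_Phi N f A B = E1 ++ [seq (tau, c) | c <- phi_columns N f A B tau] ++ E2,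
  tau \notin unzip1 E1, tau \notin unzip1 E2 & <<unzip2 E1>>%VS = L (f tau).-1].
Proof.
have [s1 [s2 [e t1 t2 U1 s1E]]] := cells_split f_inj tau.
have unzip (s : seq X) : tau \notin s ->
  tau \notin unzip1 [seq (t, c) | t <- s, c <- phi_columns N f A B t].
  move=> ts; apply: contra ts => /mapP[[t c] /allpairsPdep[t' [c' [t's _ [-> _]]]] /= ->] //.
exists [seq (t, c) | t <- s1, c <- phi_columns N f A B t].
exists [seq (t, c) | t <- s2, c <- phi_columns N f A B t].
split; try exact: unzip.
  by rewrite /D_Phi e allpairs_cat /=.
rewrite -(phi_columns_before U1 s1E) /unzip2 map_flatten -map_comp; congr <<flatten _>>%VS.
by apply: eq_map => s /=; rewrite -map_comp map_id.
Qed.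

Lemma double_columnE tau : double_column N f A B tau <-> is_double (f tau).
Proof.
have [E1 [E2 [e n1 n2 _]]] := D_Phi_split tau.
rewrite /double_column e /unzip1 !map_cat !count_cat -map_comp.
rewrite (count_memPn n1) (count_memPn n2) add0n addn0 (@eq_map _ _ _ (fun=> tau)) //.
rewrite count_map (eq_count (a2 := predT)) => [|c]; last by rewrite /= eqxx.
rewrite count_predT phi_columnsE /is_double.
by case: (lead f PA _); case: (lead f PB _); case: (lead f ZX _);
  case: ifP => //=; rewrite ?if_same.
Qed.

Lemma second_columnE rho tau c1 c2 : phi_columns N f A B tau = [:: c1; c2] ->
  exists2 D1, <<D1>>%VS = L (f tau).-1 &
    second_column N f A B rho tau
      = reduce_column rho id (column_reduction rho id (rcons D1 c1)) c2.
Proof.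
move=> phi; have [E1 [E2 [e n1 n2 sp]]] := D_Phi_split tau.
exists (unzip2 E1) => //; rewrite /second_column /R_Phi e phi /=.
have -> : unzip2 (E1 ++ (tau, c1) :: (tau, c2) :: E2) = rcons (unzip2 E1) c1 ++ c2 :: unzip2 E2.
  by rewrite cat_rcons /unzip2 map_cat.
have [R2 eR] := column_reduction_cat rho (@idfun (chain X)) (rcons (unzip2 E1) c1) c2 (unzip2 E2).
have {eR}-> : column_reduction rho id (rcons (unzip2 E1) c1 ++ c2 :: unzip2 E2) =
  column_reduction rho id (rcons (unzip2 E1) c1) ++
  reduce_column rho id (column_reduction rho id (rcons (unzip2 E1) c1)) c2 :: R2 := eR.
set r := reduce_column _ _ _ c2.
have := column_reduction_rcons rho (@idfun (chain X)) (unzip2 E1) c1.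
set r1 := reduce_column _ _ _ c1 => eR.
have {eR}-> : column_reduction rho id (rcons (unzip2 E1) c1) =
  rcons (column_reduction rho id (unzip2 E1)) r1 := eR.
have szR : size (column_reduction rho id (unzip2 E1)) = size (unzip1 E1).
  have := size_column_reduction rho (@idfun (chain X)) (unzip2 E1).
  by rewrite !size_map.
rewrite cat_rcons [unzip1 _]map_cat zip_cat // filter_cat map_cat /= eqxx /=.
rewrite (_ : [seq p <- zip _ _ | _] = [::]) //.
apply/eqP; rewrite -(negbK (_ == _)) -has_filter; apply/hasPn => p pz.
apply: contraNneq n1 => <-.
rewrite -[unzip1 E1](@unzip1_zip _ _ _ (column_reduction rho id (unzip2 E1))) ?szR //.
exact: map_f pz.
Qed.

Lemma is_doubleE tau : is_double (f tau) ->
  exists c1 c2, phi_columns N f A B tau = [:: c1; c2].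
Proof.
by rewrite phi_columnsE => /and3P[-> -> ->] /=; case: ifP => _; do 2 eexists.
Qed.

Lemma filt_sum_nondouble tau : ~~ is_double (f tau) ->
  exists2 c : chain X, c tau = 1 & (L (f tau) <= L (f tau).-1 + <[c]>)%VS.
Proof.
have [_ hA] := V_Im_lead N f_inj f_gt0 A tau; have [_ hB] := V_Im_lead N f_inj f_gt0 B tau.
rewrite -span_phi_columns phi_columnsE /is_double.
case: (lead f PA _); case: (lead f PB _); case: (lead f ZX _) => //= _; rewrite ?if_same.
all: try by exists (VA tau) => //; rewrite ?span_seq1 // span_nil addvS ?sub0v.
by exists (VB tau); rewrite ?span_seq1.
Qed.

(** A combination that involves c contains tau, so it is not supported on the cells
before tau. *)
Lemma filt_sum_line tau (c u : chain X) : c tau = 1 -> u \in (L (f tau).-1 + <[c]>)%VS ->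
  u \in upto f (f tau).-1 -> u \in L (f tau).-1.
Proof.
move=> c1 /memv_addP[l lL [_ /vlineP[k ->] ->]].
have := subvP (filt_sum_upto _) _ lL; rewrite !upto_pred // => /andP[_ /eqP l0] /andP[_].
rewrite !ffunE l0 c1 add0r => /eqP k0; rewrite (_ : k = 0) ?scale0r ?addr0 //.
by rewrite -[LHS]mulr1.
Qed.

Lemma is_double_phi tau c1 c2 : phi_columns N f A B tau = [:: c1; c2] ->
  is_double (f tau) /\ c1 = (if tau \in A then VA tau else VB tau).
Proof.
rewrite phi_columnsE /is_double.
case: (lead f PA _); case: (lead f PB _); case: (lead f ZX _) => //=; case: ifP => //= _.
all: by case.
Qed.

(** This depends on which of the two columns comes first: if tau is in A or B,
it is still missing from L_(i-1), and it is recovered from the first column c1 only if c1 comes from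
the subcomplex that contains tau. *)
Lemma chains_filt_sum tau c1 c2 : phi_columns N f A B tau = [:: c1; c2] ->
  (filt f (chains (A :|: B)) (f tau) <= L (f tau).-1 + <[c1]>)%VS.
Proof.
case/is_double_phi => /and3P[lA lB _] ->.
apply/subvP => c; rewrite memv_cap => /andP[cAB ci].
have low_in x : x \in chains (A :|: B) -> x \in upto f (f tau).-1 -> x \in L (f tau).-1.
  by move=> xAB xi; apply: (subvP (filt_chainsU f subA subB _)); rewrite memv_cap xAB.
have [c0|/F2_neq0 ctau] := eqVneq (c tau) 0.
  by apply: subvP (addvSl _ _) _ _; rewrite low_in // upto_pred // ci c0 eqxx.
have tAB : tau \in A :|: B by move/chainsP: cAB; apply; rewrite ctau.
have step S : lead f (relcycles S) (f tau) -> tau \in S -> subcomplex S ->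
    (filt f (relcycles S) (f tau).-1 <= L (f tau).-1)%VS ->
    c \in (L (f tau).-1 + <[V_Im N f S tau]>)%VS.
  move=> lS tS sS sub; rewrite -(subrK (V_Im N f S tau) c) memv_add ?memv_line //.
  rewrite -(subrKA (cell_chain tau)) memvD //.
    have tc : cell_chain tau \in chains (A :|: B) by rewrite mem_cell_chain.
    by apply: low_in; [rewrite memvB | rewrite sub_cell_chain // ci ctau].
  apply: (subvP sub); rewrite -opprB memvN memv_cap V_Im_sub // andbT memvB ?V_Im_relcycles //.
  by apply: (subvP (chains_relcycles sS)); rewrite mem_cell_chain.
case: ifP => tA; first by apply: step => //; exact: addvSl.
move: tAB; rewrite inE tA /= => tB; apply: step => //; exact: addvSr.
Qed.

(** At a double time L grows by two dimensions. *)
Lemma filt_sum_double tau c1 c2 : phi_columns N f A B tau = [:: c1; c2] ->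
  c2 \notin (L (f tau).-1 + <[c1]>)%VS.
Proof.
move=> phi; have [/and3P[lA lB nZ] _] := is_double_phi phi.
apply/negP => c2M; have : (L (f tau) <= L (f tau).-1 + <[c1]>)%VS.
  rewrite -span_phi_columns phi span_cons span_seq1 addvA subv_add subvv.
  by rewrite -memvE.
move/dimvS; have := (dimv_add_leqif (L (f tau).-1) <[c1]>).1.
have := @dim_filt_sum X f PA PB (f tau); have := @dim_filt_sum X f PA PB (f tau).-1.
rewrite relcyclesI // !(dim_filt f_inj f_gt0 _ (f tau)) lA lB (negPf nZ) dim_vline.
by case: (c1 != 0); lia.
Qed.

Section SecondColumn.
Context (rho : X -> nat).
Hypothesis rho_order : phi_order f A B rho.

(** The chain r is the reduced second column without its cells in A and B; any chain
u of L_i outside L_(i-1) that is supported before tau is at least as late as r,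
and equals r up to L_(i-1). *)
Lemma second_column_low tau : is_double (f tau) -> exists sigma (r : chain X),
  [/\ low rho (second_column N f A B rho tau) = Some sigma, (f sigma < f tau)%N,
      [/\ r \in L (f tau), r \notin L (f tau).-1, r \in upto f (f sigma) & r sigma = 1]
    & forall b (u : chain X), (b < f tau)%N -> u \in L (f tau) -> u \notin L (f tau).-1 ->
        u \in upto f b -> (f sigma <= b)%N /\ u - r \in L (f tau).-1].
Proof.
case: rho_order => rho_inj rho_AB rho_out /is_doubleE[c1 [c2 phi]].
have c1P := @phi_columns_lead tau c1; have c2P := @phi_columns_lead tau c2.
rewrite phi !inE !eqxx orbT in c1P c2P.
have [[// c1u c11] [// c2u c21]] := (c1P isT, c2P isT).
have [D1 spD secE] := second_columnE rho phi; set R := second_column _ _ _ _ _ _ in secE *.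
set M := (L (f tau).-1 + <[c1]>)%VS.
have spM : <<rcons D1 c1>>%VS = M by rewrite span_rcons spD.
have LM : L (f tau) = (M + <[c2]>)%VS.
  by rewrite -span_phi_columns phi span_cons span_seq1 addvA.
have c2M := filt_sum_double phi.
(* Over F_2 all chains of L_i outside M differ from c2 by elements of M. *)
have coset u : u \in L (f tau) -> u \notin M -> u - c2 \in M.
  rewrite LM => /memv_addP[m mM [_ /vlineP[k ->] ->]].
  have [->|/F2_neq0 ->] := eqVneq k 0; first by rewrite scale0r addr0 mM.
  by rewrite scale1r addrK.
have lowM u : u \in upto f (f tau).-1 -> u \in M -> u \in L (f tau).-1.
  by move=> uu uM; apply: filt_sum_line uu; [exact: c11|].
have RM : R - c2 \in M.
  rewrite secE -spM;
  have := reduce_column_sub rho (@idfun (chain X)) (column_reduction rho idfun (rcons D1 c1)) c2.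
  by rewrite span_column_reduction.
have RnM : R \notin M.
  by apply: contra c2M => RM'; rewrite -(subKr R c2) memvB.
have RL : R \in L (f tau).
  by rewrite LM -(subrK c2 R) memv_add ?memv_line.
have Rn0 : R != 0 by apply: contraNneq RnM => ->; rewrite mem0v.
have [sigma ls] := low_exists rho_inj Rn0.
have lowmin u : u \in L (f tau) -> u \notin M -> exists2 t, u t != 0 & (rho sigma <= rho t)%N.
  move=> uL uM;
  apply: (reduced_low_min rho_inj (col := idfun) (D := rcons D1 c1) (w := c2) (u := u)).
    by rewrite /= -ls secE.
  by rewrite spM coset.
have [Rs max] := (low_some rho_inj _ _).1 ls.
have Rup := subvP (filt_sum_upto _) _ RL.
(* The rows of A and B come first, so otherwise R would be a chain of A u B. *)
have sAB : sigma \notin A :|: B.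
  apply: contra RnM => sAB; apply: (subvP (chains_filt_sum phi)).
  rewrite memv_cap Rup andbT; apply/chainsP => t /max; apply: contraTT => tAB.
  by rewrite -ltnNge rho_AB.
pose r2 : chain X := [ffun s => if s \in A :|: B then R s else 0].
have r2AB : r2 \in filt f (chains (A :|: B)) (f tau).
  rewrite memv_cap; apply/andP; split; [apply/chainsP|apply/uptoP] => s; rewrite ffunE.
    by case: ifP => //; rewrite eqxx.
  by case: ifP => _; [move/uptoP: Rup; apply | rewrite eqxx].
have r2M := subvP (chains_filt_sum phi) _ r2AB.
have rE s : (R - r2) s = if s \in A :|: B then 0 else R s.
  by rewrite !ffunE; case: ifP; rewrite ?subrr ?subr0.
have ru : R - r2 \in upto f (f sigma).
  apply/uptoP => t; rewrite rE; case: ifPn => [|tAB /max]; rewrite ?eqxx //.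
  by rewrite leqNgt rho_out // -leqNgt.
have rL : R - r2 \in L (f tau).
  by rewrite memvB //; apply: (subvP (filt_chainsU f subA subB _)).
have rM : R - r2 \notin M.
  by apply: contra RnM => rM; rewrite -(subrK r2 R) memvD.
have bound b u : u \in L (f tau) -> u \notin M -> u \in upto f b -> (f sigma <= b)%N.
  move=> uL uM /uptoP ub; have [t ut st] := lowmin u uL uM.
  have tAB : t \notin A :|: B.
    by apply: contraTN st => tAB; rewrite -ltnNge rho_AB.
  by apply: leq_trans (ub t ut); rewrite leqNgt -rho_out // -leqNgt.
have predM u : u \notin L (f tau).-1 -> u \in upto f (f tau).-1 -> u \notin M.
  by move=> uL uu; apply: contra uL; apply: lowM.
have LpM u : u \notin M -> u \notin L (f tau).-1 by apply: contra; apply/subvP/addvSl.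
(* Since c1 and c2 have the same last cell tau, their difference is a chain of an
   earlier stage to which the bound applies; it shows that sigma precedes tau. *)
have c12u : c2 - c1 \in upto f (f tau).-1 by rewrite upto_sub // c11.
have c12M : c2 - c1 \notin M.
  apply: contra c2M => h; rewrite -(subrK c1 c2) memvD //.
  by apply: (subvP (addvSr _ _)); rewrite memv_line.
have c1L : c1 \in L (f tau).
  by rewrite LM; apply: (subvP (addvSl _ _)); apply: (subvP (addvSr _ _)); rewrite memv_line.
have c2L : c2 \in L (f tau) by rewrite LM; apply: (subvP (addvSr _ _)); rewrite memv_line.
have sigma_pred : (f sigma <= (f tau).-1)%N by apply: bound c12M c12u; rewrite memvB.
exists sigma, (R - r2); split=> //.
- by rewrite (leq_ltn_trans sigma_pred) // ltn_predL.
- split=> //; [exact: LpM | by rewrite rE (negPf sAB); apply/F2_neq0].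
move=> b u lt uL unL ub; have up : u \in upto f (f tau).-1.
  by apply: subvP ub; apply: uptoS; exact: leq_pred_lt.
have uM := predM u unL up; split; first exact: bound ub.
apply: lowM.
  by rewrite memvB //; apply: subvP ru; apply: uptoS.
by rewrite -(subrKA c2) memvD ?coset // -opprB memvN coset.
Qed.


End SecondColumn.
End PhiMatrix.

(** * Births, deaths and pairs of the cokernel *)

Lemma paired_inj (M : persistence_module) b b' d : paired M b d -> paired M b' d -> b = b'.
Proof.
move=> [_ _ _ cb mb] [_ _ _ cb' mb']; case: (ltngtP b b') => // h.
  by have := mb' b h; rewrite cb.
by have := mb b' h; rewrite cb'.
Qed.

Section Main.
Context (X : cell_complex) (N : nat) (f : X -> nat).
Hypotheses (f_inj : injective f) (f_gt0 : forall s, (0 < f s)%N) (f_le : forall s, (f s <= N)%N).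
Hypotheses (f_mono : forall t s, face t s -> (f t <= f s)%N).
Context (A B : {set X}).
Hypotheses (subA : subcomplex A) (subB : subcomplex B) (disjAB : [disjoint A & B]).

Local Notation ZX := (lker (boundary X)).
Local Notation PA := (relcycles A).
Local Notation PB := (relcycles B).
Local Notation P := (relcycles (A :|: B)).
Local Notation L := (filt_sum f PA PB).
Local Notation Cok := (Cok_Phi_module f A B).

Lemma birth_Cok t : birth Cok t <-> [&& lead f P t, ~~ lead f PA t & ~~ lead f PB t].
Proof.
by apply: (birth_lead f_inj f_gt0 _ _ (Cok_presents f_mono subA subB));
  rewrite relcyclesS ?subsetUl ?subsetUr.
Qed.

Lemma death_Cok t : death Cok t <-> is_double f A B t.
Proof.
rewrite /is_double -(relcyclesI disjAB).
by apply: (death_lead f_inj f_gt0 _ _ (Cok_presents f_mono subA subB));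
  rewrite relcyclesS ?subsetUl ?subsetUr.
Qed.

Lemma lead_chains S s : lead f (chains S) (f s) = (s \in S).
Proof.
apply/leadP/idP => // [[c [/chainsP cS _ c1]]|sS]; first by rewrite cS ?c1.
by exists (cell_chain s); rewrite mem_cell_chain cell_chain_upto ffunE eqxx.
Qed.

Lemma birth_Ker S s : subcomplex S -> birth (Ker_module f S) (f s) <->
  [&& lead f (relcycles S) (f s), s \notin S & ~~ lead f ZX (f s)].
Proof.
move=> sS; rewrite -(lead_chains S).
by apply: (birth_lead f_inj f_gt0 _ _ (Ker_presents f_mono sS));
  rewrite ?lker_relcycles ?chains_relcycles.
Qed.

Lemma birth_cell (M : persistence_module) W U V q t :
  (U <= W)%VS -> (V <= W)%VS -> presents (M := M) (filt f W) (filt_sum f U V) q ->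
  birth M t -> exists s, f s = t.
Proof.
by move=> UW VW pres /(birth_lead f_inj f_gt0 UW VW pres)/and3P[/lead_cell].
Qed.

(** A cell of A is last in a chain of P^A, namely the cell itself, so the births of
the cokernel are at cells outside A and B; there the birth of a kernel class for
S means that the cell is last in a chain of P^S but in no cycle. *)
Lemma birth_declared t : birth Cok t <-> declared_birth f A B t.
Proof.
have sAB := subcomplexU subA subB.
have cell : birth Cok t \/ declared_birth f A B t -> exists s, f s = t.
  case=> [/birth_Cok/and3P[/lead_cell //] | [+ _ _]].
  by apply: birth_cell (Ker_presents f_mono sAB); rewrite ?lker_relcycles ?chains_relcycles.
suff main : (exists s, f s = t) -> birth Cok t <-> declared_birth f A B t.
  by split=> h; apply/main => //; apply: cell; [left | right].
case=> s <-.
have bC := birth_Cok (f s); have bU := birth_Ker s sAB.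
have bA := birth_Ker s subA; have bB := birth_Ker s subB.
have leadS S : subcomplex S -> (s \in S) ==> lead f (relcycles S) (f s).
  move=> sS; apply/implyP => s_S; apply: lead_sub (chains_relcycles sS) _.
  by rewrite lead_chains.
have : [/\ (s \in A) ==> lead f PA (f s), (s \in B) ==> lead f PB (f s),
    lead f ZX (f s) ==> lead f PA (f s) & lead f ZX (f s) ==> lead f PB (f s)].
  by split; first [exact: leadS | apply/implyP; apply: lead_sub; exact: lker_relcycles].
rewrite !inE in bU.
move=> H; split=> [/bC|[/bU birthU nA nB]].
  by move=> birthC; split; [apply/bU | move/bA | move/bB]; move: H birthC;
  case: (s \in A); case: (s \in B); case: (lead f PA _); case: (lead f PB _);
  case: (lead f ZX _); case: (lead f P _) => //= -[].
apply/bC.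
have {nA} : ~~ [&& lead f PA (f s), s \notin A & ~~ lead f ZX (f s)] by apply/negP => /bA.
have {nB} : ~~ [&& lead f PB (f s), s \notin B & ~~ lead f ZX (f s)] by apply/negP => /bB.
move: H birthU.
by case: (s \in A); case: (s \in B); case: (lead f PA _); case: (lead f PB _);
  case: (lead f ZX _); case: (lead f P _) => //= -[].
Qed.

(** Away from the double times L grows by at most one chain, whose last cell is the
new one, so no relation between older chains appears. *)
Lemma death_of_relation i x : x \in L i -> x \in upto f i.-1 -> x \notin L i.-1 ->
  exists2 tau, is_double f A B (f tau) & f tau = i.
Proof.
move=> xL xu nx.
have [tau /eqP ft|none] := pickP (fun s => f s == i).
  exists tau => //; apply/negPn/negP => nd.
  have [c c1 cL] := filt_sum_nondouble f_inj f_gt0 f_le nd.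
  move/negP: nx; apply; rewrite -ft; apply: (filt_sum_line f_inj f_gt0 c1).
    by apply: (subvP cL); rewrite ft.
  by rewrite ft.
have nl U : ~~ lead f U i.
  by apply/negP => /lead_cell[s fs]; move: (none s); rewrite fs eqxx.
by move: xL nx; rewrite /filt_sum (filt_nlead (nl PA)) (filt_nlead (nl PB)) => ->.
Qed.

Section Rho.
Context (rho : X -> nat).
Hypothesis rho_order : phi_order f A B rho.

Lemma double_paired tau : is_double f A B (f tau) -> exists sigma (r : chain X),
  [/\ low rho (second_column N f A B rho tau) = Some sigma, paired Cok (f sigma) (f tau),
      [/\ r \in L (f tau), r \notin L (f tau).-1, r \in upto f (f sigma) & r sigma = 1]
    & forall b (u : chain X), (b < f tau)%N -> u \in L (f tau) -> u \notin L (f tau).-1 ->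
        u \in upto f b -> (f sigma <= b)%N /\ u - r \in L (f tau).-1].
Proof.
move=> dbl; have [sigma [r [ls lt [rL rn ru r1] min]]] :=
  second_column_low f_inj f_gt0 f_le subA subB disjAB rho_order dbl.
have pres := Cok_presents f_mono subA subB.
exists sigma, r; split=> //.
have rP : r \in P.
  by have := subvP (presents_sub pres _) _ rL; rewrite memv_cap => /andP[].
(* If sigma were last in a chain c of P^A or P^B, then r - c would be in the class of
   r and supported before sigma, against the minimality of sigma. *)
have nlead S : (filt f (relcycles S) (f sigma) <= L (f sigma))%VS ->
    ~~ lead f (relcycles S) (f sigma).
  move=> sub; apply/negP => /(leadP f_inj f_gt0)[c [cS cu c1]].
  have cL : c \in L (f tau).-1.
    have /(subvP sub) cs : c \in filt f (relcycles S) (f sigma) by rewrite memv_cap cS.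
    by apply: subvP cs; apply: filt_sumS; exact: leq_pred_lt.
  have [] := min (f sigma).-1 (r - c).
  - exact: leq_ltn_trans (leq_pred _) lt.
  - by rewrite memvB //; apply: subvP cL; apply: filt_sumS; apply: leq_pred.
  - by apply: contra rn => h; rewrite -(subrK c r) memvD.
  - by apply: upto_sub; rewrite ?c1.
  by rewrite leqNgt ltn_predL f_gt0.
split=> //.
- apply/birth_Cok; rewrite !nlead ?addvSl ?addvSr // !andbT.
  by apply/leadP => //; exists r.
- exact/death_Cok.
- by apply/(class_diesP pres lt); exists r; rewrite memv_cap rP ru.
move=> b lb; apply/negP => /(class_diesP pres (ltn_trans lb lt))[c [cb cL cn]].
have [|le _] := min b c (ltn_trans lb lt) cL cn.
  by move: cb; rewrite memv_cap => /andP[].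
by rewrite leqNgt lb in le.
Qed.

Lemma paired_double b d : paired Cok b d -> exists tau, is_double f A B (f tau) /\ f tau = d.
Proof.
case=> _ /death_Cok dd _ _ _; have [tau ft] : exists tau, f tau = d.
  by case/and3P: dd => /lead_cell.
by exists tau; rewrite ft.
Qed.

Lemma matched_paired b d : matched N f A B rho b d <-> paired Cok b d.
Proof.
split=> [[tau [sigma [/(double_columnE f_inj f_gt0 f_le) dbl ls -> ->]]] | pbd].
  have [sigma' [r []]] := double_paired dbl.
  by rewrite ls => -[<-].
have [tau [dbl ft]] := paired_double pbd.
have [sigma [r [ls pr _ _]]] := double_paired dbl.
exists tau, sigma; split=> //; first exact/double_columnE.
by apply: paired_inj pbd _; rewrite -ft.
Qed.

Lemma unpaired_alive t : birth Cok t -> unpaired_birth Cok t <-> alive_at Cok N t.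
Proof.
move=> bt; have pres := Cok_presents f_mono subA subB.
have /birth_Cok/and3P[lP nA nB] := bt.
have [sigma fs] := lead_cell lP.
have tN : (t <= N)%N by rewrite -fs.
have predN : (t.-1 <= N)%N by exact: leq_trans (leq_pred t) tN.
have t0 : (0 < t)%N by rewrite -fs.
have Lt : L t = L t.-1 by rewrite /filt_sum (filt_nlead nA) (filt_nlead nB).
rewrite /unpaired_birth /alive_at (limg_pmap_sub pres tN predN).
split=> -[_ unp]; split=> //; last first.
  move=> d pbd; have [tau [dbl ft]] := paired_double pbd.
  have [sigma' [r [_ pr [rL _ ru r1] _]]] := double_paired dbl.
  have ss' : f sigma' = t by apply: paired_inj pr _; rewrite ft.
  move/negP: unp; apply; rewrite -ss' (@filt_lead X f f_inj f_gt0 P sigma' r) //.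
    apply: addvS => //; rewrite -memvE; apply: subvP rL; exact: filt_sumS.
  by have := subvP (presents_sub pres _) _ rL; rewrite memv_cap => /andP[].
apply/negP => sub.
(* Some chain of L_i has the cell of t as its last cell. *)
pose dies i := ~~ (L i :&: upto f t <= upto f t.-1)%VS.
have ex : exists i, dies i.
  exists N; move: lP; rewrite -fs => /(leadP f_inj f_gt0)[c [cP cu c1]].
  have /(subvP sub) : c \in filt f P t by rewrite memv_cap cP -fs.
  case/memv_addP => p pP [x xL cx]; apply/negP => /subvP /(_ x).
  have [_ pu] : p \in P /\ p \in upto f t.-1 by apply/andP; rewrite -memv_cap.
  have xe : x = c - p by rewrite cx addrC addKr.
  have xt : x \in upto f t.
    rewrite xe memvB //; first by rewrite -fs.
    by apply: subvP pu; apply: uptoS; apply: leq_pred.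
  rewrite memv_cap xL xt => /(_ isT) xu.
  have := memvD pu xu; rewrite -cx -fs upto_pred // c1 andbF //.
case: (ex_minnP ex) => i /subvPn[x] /[!memv_cap] /andP[xL xt] xn mini.
have ti : (t < i)%N.
  rewrite ltnNge; apply: contra xn => it.
  apply: (subvP (filt_sum_upto f A B t.-1)); rewrite -Lt.
  by apply: subvP xL; apply: filt_sumS.
have small y : y \in L i.-1 -> y \in upto f t -> y \in upto f t.-1.
  move=> yL yt; apply/negPn/negP => yn.
  have : (i <= i.-1)%N by apply: mini; apply/subvPn; exists y; rewrite ?memv_cap ?yL.
  by rewrite leqNgt ltn_predL (leq_ltn_trans (leq0n t) ti).
have xL' : x \notin L i.-1 by apply: contra xn => xL'; apply: small.
have [tau dbl ft] : exists2 tau, is_double f A B (f tau) & f tau = i.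
  by apply: (death_of_relation xL) => //; apply: subvP xt; apply: uptoS; exact: leq_pred_lt.
have [sigma' [r [_ pr [rL rn ru r1] min]]] := double_paired dbl.
rewrite ft in rL rn min pr.
have [le xr] := min t x ti xL xL' xt.
case: (unp i); suff -> : t = f sigma' by [].
(* If the death at i were paired with an earlier birth, then r would be supported before
   t, and x - r would be a chain of L_(i-1) with the same last cell as x. *)
apply/eqP; rewrite eqn_leq le andbT leqNgt; apply/negP => lt.
move/negP: xn; apply; rewrite -(subrK r x).
have rt : r \in upto f t.-1 by apply: subvP ru; apply: uptoS; exact: leq_pred_lt.
apply: memvD => //; apply: small => //; apply: memvB => //.
by apply: subvP rt; apply: uptoS; apply: leq_pred.
Qed.

End Rho.
End Main.

Theorem theorem4p1 (X : cell_complex) (N : nat) (f : X -> nat)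
    (A B : {set X}) (rho : X -> nat) :
  is_filter_map N f ->
  subcomplex A -> subcomplex B -> [disjoint A & B] -> A != set0 -> B != set0 ->
  phi_order f A B rho ->
  let Cok := Cok_Phi_module f A B in
  [/\ forall d, death Cok d <-> exists2 tau, double_column N f A B tau & f tau = d,
      forall tau, double_column N f A B tau ->
        exists2 sigma, low rho (second_column N f A B rho tau) = Some sigma
          & paired Cok (f sigma) (f tau),
      forall t, birth Cok t <-> declared_birth f A B t
    & forall t, birth Cok t ->
        ((forall d, ~ matched N f A B rho t d) <-> unpaired_birth Cok t) /\
        ((forall d, ~ matched N f A B rho t d) <-> alive_at Cok N t)].
Proof.
case=> f_inj f_im f_mono subA subB disjAB _ _ rho_order.
have f_rng s : (1 <= f s <= N)%N by apply/f_im; exists s.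
have f_gt0 s : (0 < f s)%N by case/andP: (f_rng s).
have f_le s : (f s <= N)%N by case/andP: (f_rng s).
move=> Cok; split.
- move=> d; rewrite (death_Cok f_inj f_gt0 f_mono subA subB disjAB).
  split=> [dd | [tau /(double_columnE f_inj f_gt0 f_le) dbl <-] //].
  have [tau ft] : exists tau, f tau = d by case/and3P: dd => /lead_cell.
  by exists tau => //; apply/double_columnE => //; rewrite ft.
- move=> tau /(double_columnE f_inj f_gt0 f_le) dbl.
  have [sigma [r [ls pr _ _]]] :=
    double_paired f_inj f_gt0 f_le f_mono subA subB disjAB rho_order dbl.
  by exists sigma.
- exact: birth_declared.
move=> t bt.
have mp d := matched_paired f_inj f_gt0 f_le f_mono subA subB disjAB rho_order t d.
have mu : (forall d, ~ matched N f A B rho t d) <-> unpaired_birth Cok t.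
  by split=> [h | [_ h] d /mp /h //]; split=> // d /mp /h.
split=> //; rewrite mu.
exact: (unpaired_alive f_inj f_gt0 f_le f_mono subA subB disjAB rho_order).
Qed.
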